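(* Let $N\ge1$, let $\Omega\subset\mathbb{R}^N$ be a bounded open set with $0\in\Omega$, and let $K\subset\Omega$ be compact. For every $\varepsilon>0$ let $K_\varepsilon=\varepsilon K$. Let $s\in(0,\min\{1,N/2\})$ and $j\in\mathbb{N}$, $j\ge1$, let $\lambda_j^s(\Omega)$ be the $j$-th Dirichlet eigenvalue of $(-\Delta)^s$ in $\Omega$, and let $u_j\in\mathcal{D}^{s,2}(\Omega)$ be an eigenfunction associated to $\lambda_j^s(\Omega)$ normalized by $\int_\Omega|u_j|^2dx=1$. Let $\gamma_s$ and $\hat\psi$ be the exponent and the homogeneous limit profile describing the behavior of $u_j$ at $0$ (as defined in the context). Then, as $\varepsilon\to0^+$, $$\mathrm{Cap}^s_\Omega(K_\varepsilon,u_j)=\varepsilon^{N+2(\gamma_s-s)}\left\{\mathrm{Cap}^s_{\mathbb{R}^N}(K,\hat\psi)+o(1)\right\}.$$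
   Context: For an open set $\Omega\subset\mathbb{R}^N$ (bounded or unbounded) and $s\in(0,\min\{1,N/2\})$, $\mathcal{D}^{s,2}(\Omega)$ is the completion of $C^\infty_c(\Omega)$ with respect to the Gagliardo norm $[u]_{H^s(\mathbb{R}^N)}=\big(\int_{\mathbb{R}^N}\int_{\mathbb{R}^N}\frac{|u(x)-u(y)|^2}{|x-y|^{N+2s}}dx\,dy\big)^{1/2}$ (functions extended by $0$ outside $\Omega$, so that $\mathcal{D}^{s,2}(\Omega)\subset\mathcal{D}^{s,2}(\mathbb{R}^N)$). It is a Hilbert space with scalar product $$(u,v)_{\mathcal{D}^{s,2}(\Omega)}=\frac{C(N,s)}{2}\int_{\mathbb{R}^N}\int_{\mathbb{R}^N}\frac{(u(x)-u(y))(v(x)-v(y))}{|x-y|^{N+2s}}\,dx\,dy,\qquad C(N,s)=\pi^{-N/2}2^{2s}\frac{\Gamma(\frac{N+2s}{2})}{\Gamma(2-s)}s(1-s),$$ and norm $\|u\|_{\mathcal{D}^{s,2}(\Omega)}=(u,u)_{\mathcal{D}^{s,2}(\Omega)}^{1/2}$. Eigenvalues: for a bounded open set $\Omega$, $\lambda\in\mathbb{R}$ is an eigenvalue of the restricted fractional Laplacian $(-\Delta)^s$ in $\Omega$ with homogeneous Dirichlet conditions in $\mathbb{R}^N\setminus\Omega$ if there is $u\in\mathcal{D}^{s,2}(\Omega)\setminus\{0\}$ (an eigenfunction) with $(u,v)_{\mathcal{D}^{s,2}(\Omega)}=\lambda\int_{\mathbb{R}^N}uv\,dx$ for all $v\in\mathcal{D}^{s,2}(\Omega)$.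 The eigenvalues form a diverging sequence $0<\lambda_1^s(\Omega)\le\lambda_2^s(\Omega)\le\dots\to+\infty$, repeated according to their (finite) multiplicity. Capacity: for an open set $\Omega$ (bounded, or $\Omega=\mathbb{R}^N$), $K\subset\Omega$ compact and $u\in H^s_{\rm loc}(\Omega)$, let $\zeta_K\in C^\infty_c(\Omega)$ be such that $\zeta_K=1$ in a neighborhood of $K$; then $$\mathrm{Cap}^s_\Omega(K,u)=\inf\{\|w\|^2_{\mathcal{D}^{s,2}(\Omega)}: w\in\mathcal{D}^{s,2}(\Omega),\ w-\zeta_Ku\in\mathcal{D}^{s,2}(\Omega\setminus K)\};$$ for $u\in\mathcal{D}^{s,2}(\Omega)$ the condition is equivalent to $w-u\in\mathcal{D}^{s,2}(\Omega\setminus K)$. (For $\varepsilon$ small, $\varepsilon K\subset\Omega$, so $\mathrm{Cap}^s_\Omega(\varepsilon K,u_j)$ is defined.) Definition of $\gamma_s$ and $\hat\psi$: let $\mathbb{S}^N_+=\{\theta\in\mathbb{S}^N:\theta_{N+1}>0\}\subset\mathbb{R}^{N+1}$ and $\mathbf{e}_{N+1}=(0,\dots,0,1)$. Consider the (weakly formulated, in the Sobolev space weighted by $\theta_{N+1}^{1-2s}$) eigenvalue problem $$-\mathrm{div}_{\mathbb{S}^N}(\theta_{N+1}^{1-2s}\nabla_{\mathbb{S}^N}\psi)=\mu\,\theta_{N+1}^{1-2s}\psi\ \text{ in }\mathbb{S}^N_+,\qquad -\lim_{\theta_{N+1}\to0^+}\theta_{N+1}^{1-2s}\nabla_{\mathbb{S}^N}\psi\cdot\mathbf{e}_{N+1}=0\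 \text{ on }\partial\mathbb{S}^N_+,$$ whose eigenvalues form a diverging sequence $0=\mu_1^s<\mu_2^s\le\mu_3^s\le\cdots$. It is known (Fall–Felli) that there exist $k_0\ge1$ and an eigenfunction $\psi\not\equiv0$ of this problem associated to $\mu_{k_0}^s$ such that, setting $$\gamma_s=-\frac{N-2s}{2}+\sqrt{\Big(\frac{N-2s}{2}\Big)^2+\mu_{k_0}^s},\qquad \hat\psi(x)=|x|^{\gamma_s}\psi\Big(\frac{x}{|x|},0\Big),\quad x\in\mathbb{R}^N,$$ one has $\varepsilon^{-\gamma_s}u_j(\varepsilon x)\to\hat\psi(x)$ in $H^s(B_R')$ as $\varepsilon\to0^+$ for every $R>0$, where $B_R'=\{x\in\mathbb{R}^N:|x|<R\}$; moreover $\hat\psi\not\equiv0$. *)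

(* Defs.v *)
From HB Require Import structures.
From mathcomp Require Import all_boot all_order all_algebra.
From mathcomp Require Import all_classical all_reals all_analysis.
From mathcomp Require Import measurable_realfun.

Set Implicit Arguments.
Unset Strict Implicit.
Unset Printing Implicit Defensive.

Import Order.TTheory GRing.Theory Num.Theory.
Import numFieldNormedType.Exports.

Local Open Scope classical_set_scope.
Local Open Scope ring_scope.

(* The product sigma-algebra on ['rV_n], as the library does for tuples; it is
   the Borel sigma-algebra of the topology of ['rV_n]. *)
Section rV_measurable.
Context (R : realType) (n : nat).

Let coord (i : 'I_n) (x : 'rV[R]_n) : R := x ord0 i.

Let rV_set0 : g_sigma_preimage coord set0.
Proof. exact: sigma_algebra0. Qed.

Let rV_setC A : g_sigma_preimage coord A -> g_sigma_preimage coord (~` A).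
Proof. exact: sigma_algebraC. Qed.

Let rV_bigcup (F : (set 'rV[R]_n)^nat) :
  (forall i, g_sigma_preimage coord (F i)) ->
  g_sigma_preimage coord (\bigcup_i (F i)).
Proof. exact: sigma_algebra_bigcup. Qed.

HB.instance Definition _ := @isMeasurable.Build
  (measure_tuple_display default_measure_display) 'rV[R]_n
  (g_sigma_preimage coord) rV_set0 rV_setC rV_bigcup.

End rV_measurable.

Lemma measurable_coord (R : realType) n (i : 'I_n) :
  measurable_fun [set: 'rV[R]_n] (fun x : 'rV[R]_n => x ord0 i).
Proof.
move=> _ Y mY; rewrite setTI; apply: sub_sigma_algebra => /=.
rewrite -bigcup_seq/=; exists i => /=; first by rewrite mem_index_enum.
by exists Y => //; rewrite setTI.
Qed.

Lemma measurable_fun_rVP (R : realType) d (T : measurableType d) n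
    (f : T -> 'rV[R]_n) :
  measurable_fun setT f <->
  forall i, measurable_fun setT (fun x => f x ord0 i).
Proof.
split=> [mf i|mf].
  exact: (measurableT_comp (@measurable_coord R n i) mf).
move=> _ A mA; rewrite setTI.
suff : g_sigma_preimage (fun i x => f x ord0 i) `<=` measurable.
  apply; rewrite (g_sigma_preimage_comp (fun i (x : 'rV[R]_n) => x ord0 i) f).
  by exists A => //; rewrite setTI.
apply: smallest_sub; first exact: sigma_algebra_measurable.
rewrite -bigcup_seq/= => B [i _ [C mC <-]].
exact: mf.
Qed.

Lemma sigma_finite_product d1 d2 (T1 : measurableType d1)
    (T2 : measurableType d2) (R : realType)
    (m1 : {sigma_finite_measure set T1 -> \bar R})
    (m2 : {sigma_finite_measure set T2 -> \bar R}) :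
  sigma_finite setT (m1 \x m2)%E.
Proof.
have /sigma_finiteP[F [TF ndF Foo]] := sigma_finiteT m1.
have /sigma_finiteP[G [TG ndG Goo]] := sigma_finiteT m2.
exists (fun n => F n `*` G n).
  rewrite -setXTT TF TG predeqE => -[x y]; split.
    move=> [/= [n _ Fnx] [k _ Gky]]; exists (maxn n k) => //; split.
    - by move: x Fnx; exact/subsetPset/ndF/leq_maxl.
    - by move: y Gky; exact/subsetPset/ndG/leq_maxr.
  by move=> [n _ []/= ? ?]; split; exists n.
move=> k; have [? ?] := Foo k; have [? ?] := Goo k.
split; first exact: measurableX.
by rewrite product_measure1E// lte_mul_pinfty// ge0_fin_numE.
Qed.

Section lebesgue_rV.
Context {R : realType}.

Definition rV_cons n (p : measurableTypeR R * 'rV[R]_n) : 'rV[R]_n.+1 :=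
  row_mx (p.1 : R)%:M p.2.

Lemma measurable_rV_cons n : measurable_fun setT (@rV_cons n).
Proof.
apply/measurable_fun_rVP => i.
case: (@split_ordP 1 n i) => k ->.
  rewrite (_ : (fun _ => _) = fst); first exact: measurable_fst.
  apply/funext => p.
  by rewrite /rV_cons (@row_mxEl _ 1 1 n) [k]ord1 [in LHS]mxE.
rewrite (_ : (fun _ => _) =
  (fun p : measurableTypeR R * 'rV[R]_n => p.2 ord0 k)).
  exact: (measurableT_comp (@measurable_coord R n k) measurable_snd).
by apply/funext => p; rewrite /rV_cons (@row_mxEr _ 1 1 n).
Qed.

Section lebesgue_cons.
Context (n : nat) (m : {sigma_finite_measure set 'rV[R]_n -> \bar R}).
Local Open Scope ereal_scope.

Definition lebesgue_cons : set 'rV[R]_n.+1 -> \bar R :=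
  pushforward (@lebesgue_measure R \x m) (@rV_cons n).

Let mu : {measure set 'rV[R]_n.+1 -> \bar R} :=
  measure_function_pushforward__canonical__measure_function_Measure
    (@lebesgue_measure R \x m) (@measurable_rV_cons n).

Let lebesgue_cons0 : lebesgue_cons set0 = 0.
Proof. exact: (@measure0 _ _ _ mu). Qed.

Let lebesgue_cons_ge0 A : 0 <= lebesgue_cons A.
Proof. exact: (@measure_ge0 _ _ _ mu). Qed.

Let lebesgue_cons_sigma_additive : semi_sigma_additive lebesgue_cons.
Proof. exact: (@measure_semi_sigma_additive _ _ _ mu). Qed.

HB.instance Definition _ := isMeasure.Build _ _ _ lebesgue_cons
  lebesgue_cons0 lebesgue_cons_ge0 lebesgue_cons_sigma_additive.

Let lebesgue_cons_sigma_finite : sigma_finite setT lebesgue_cons.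
Proof.
have [F FT Foo] := sigma_finite_product (@lebesgue_measure R) m.
pose g (x : 'rV[R]_n.+1) : measurableTypeR R * 'rV[R]_n :=
  (x ord0 ord0, \row_i x ord0 (lift ord0 i)).
have mg : measurable_fun setT g.
  apply: measurable_fun_pair; first exact: measurable_coord.
  apply/measurable_fun_rVP => i.
  by under eq_fun do rewrite mxE; exact: measurable_coord.
have gK p : g (rV_cons p) = p.
  case: p => a x; rewrite /g /rV_cons/=; congr pair.
    have -> : ord0 = lshift n (ord0 : 'I_1) :> 'I_n.+1 by apply/val_inj.
    by rewrite (@row_mxEl _ 1 1 n) [in LHS]mxE.
  apply/rowP => i; rewrite mxE.
  have -> : lift ord0 i = rshift 1 i by apply/val_inj.
  by rewrite (@row_mxEr _ 1 1 n).
exists (fun k => g @^-1` F k).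
  by rewrite -preimage_bigcup -FT preimage_setT.
move=> k; have [mF Fk] := Foo k; split.
  by rewrite -[X in measurable X]setTI; exact: mg.
rewrite /lebesgue_cons /pushforward -comp_preimage.
by rewrite (_ : g \o _ = id) //; apply/funext => p /=; rewrite gK.
Qed.

HB.instance Definition _ := Measure_isSigmaFinite.Build _ _ _ lebesgue_cons
  lebesgue_cons_sigma_finite.

End lebesgue_cons.

Fixpoint lebesgue_rV n : {sigma_finite_measure set 'rV[R]_n -> \bar R} :=
  match n with
  | 0 => \d_(0 : 'rV[R]_0)
  | n'.+1 => lebesgue_cons (lebesgue_rV n')
  end.

End lebesgue_rV.

Section euclidean.
Context {R : realType}.

Definition dotv n (x y : 'rV[R]_n) : R := \sum_i x ord0 i * y ord0 i.
Definition enorm n (x : 'rV[R]_n) : R := Num.sqrt (dotv x x).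
Definition eball n (r : R) : set 'rV[R]_n := [set x | enorm x < r].

Lemma measurable_enorm n : measurable_fun setT (@enorm n).
Proof.
have -> : @enorm n = (fun x => dotv x x `^ 2^-1).
  by apply/funext => x; rewrite powR12_sqrt// sumr_ge0// => i _; exact: sqr_ge0.
apply: (measurableT_comp (measurable_powR _)).
apply: measurable_sum => i.
by apply: measurable_funM; exact: measurable_coord.
Qed.

Definition direction n (x : 'rV[R]_n) : 'rV[R]_n := (enorm x)^-1 *: x.

Lemma measurable_direction n : measurable_fun setT (@direction n).
Proof.
apply/measurable_fun_rVP => i.
under eq_fun do rewrite mxE.
apply: measurable_funM; last exact: measurable_coord.
under eq_fun do rewrite -[X in X^-1]powRr1 ?sqrtr_ge0// -powRN.
exact: (measurableT_comp (measurable_powR _) (@measurable_enorm n)).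
Qed.

Definition punctured_ball n : set 'rV[R]_n := [set x | 0 < enorm x < 1].

Lemma measurable_punctured_ball n : measurable (@punctured_ball n).
Proof.
have -> : @punctured_ball n = @enorm n @^-1` `]0, 1[%classic.
  by apply/seteqP; split => x /=; rewrite in_itv.
by rewrite -[X in measurable X]setTI; exact: measurable_enorm.
Qed.

End euclidean.

(* Surface measure of the unit sphere of R^n (carried by the ambient space), as
   the cone measure: sigma(A) = n * |{x : 0 < |x| < 1, x / |x| in A}|.  For
   [n = 1] it is the counting measure of {-1, 1}. *)
Section sphere_measure.
Context {R : realType} (n : nat).
Local Open Scope ereal_scope.

Definition sphere_measure : set 'rV[R]_n -> \bar R := fun A =>
  n%:R%:E * lebesgue_rV n (@direction R n @^-1` A `&` @punctured_ball R n).

Let mu : {measure set 'rV[R]_n -> \bar R} :=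
  mscale (NngNum (ler0n R n))
  (measure_function_pushforward__canonical__measure_function_Measure
    (mrestr (lebesgue_rV n) (@measurable_punctured_ball R n))
    (@measurable_direction R n)).

Let sphere_measure0 : sphere_measure set0 = 0.
Proof. exact: (@measure0 _ _ _ mu). Qed.

Let sphere_measure_ge0 A : 0 <= sphere_measure A.
Proof. exact: (@measure_ge0 _ _ _ mu). Qed.

Let sphere_measure_sigma_additive : semi_sigma_additive sphere_measure.
Proof. exact: (@measure_semi_sigma_additive _ _ _ mu). Qed.

HB.instance Definition _ := isMeasure.Build _ _ _ sphere_measure
  sphere_measure0 sphere_measure_ge0 sphere_measure_sigma_additive.

End sphere_measure.

Section smooth_functions.
Context {R : realType} (n : nat).
Implicit Types (f : 'rV[R]_n -> R) (A : set 'rV[R]_n).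

Definition partial (i : 'I_n) f : 'rV[R]_n -> R :=
  fun x => 'D_(delta_mx ord0 i) f x.

Definition gradient f : 'rV[R]_n -> 'rV[R]_n := fun x => \row_i partial i f x.

Definition smooth f : Prop :=
  forall (l : seq 'I_n) (x : 'rV[R]_n), differentiable (foldr partial f l) x.

Definition test_function A f : Prop :=
  [/\ smooth f, compact (closure [set x | f x != 0]) &
      closure [set x | f x != 0] `<=` A].

End smooth_functions.

Section ae_dimension.
Context d (T : measurableType d) (R : realType).
Variable mu : {measure set T -> \bar R}.

Definition ae_null (D : set T) (f : T -> R) : Prop :=
  {ae mu, forall x, D x -> f x = 0}.

(* [V] is an [n]-dimensional space of functions on [D] modulo equality
   almost everywhere *)
Definition ae_dim (D : set T) (V : set (T -> R)) (n : nat) : Prop :=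
  exists e : 'I_n -> T -> R,
    [/\ forall i, V (e i),
        forall c : 'I_n -> R,
          ae_null D (fun x => \sum_i c i * e i x) -> forall i, c i = 0 &
        forall f, V f -> exists c : 'I_n -> R,
          ae_null D (fun x => f x - \sum_i c i * e i x)].

(* [lam 1 <= lam 2 <= ...] lists the [l] for which [V l] is nontrivial, each
   repeated according to the dimension of [V l]; the value [lam 0] is unused *)
Definition eigenvalue_sequence (D : set T) (V : R -> set (T -> R))
    (lam : nat -> R) : Prop :=
  [/\ forall i j, (1 <= i <= j)%N -> lam i <= lam j,
      lam k @[k --> \oo] --> +oo &
      forall l, exists2 m : nat,
        ae_dim D (V l) m & ([set k | (1 <= k)%N /\ lam k = l] #= `I_m)%card].

End ae_dimension.

Section fractional_space.
Context {R : realType} (N : nat) (s : R).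
Implicit Types (A K : set 'rV[R]_N) (f u v w zeta : 'rV[R]_N -> R).

Local Notation leb := (lebesgue_rV N).
Local Notation leb2 := (leb \x leb)%E.

Definition Gamma (x : R) : R :=
  \int[lebesgue_measure]_(t in `]0, +oo[) (t `^ (x - 1) * expR (- t)).

(* the normalization constant C(N, s) *)
Definition CNs : R :=
  pi `^ (- (N%:R / 2)) * 2 `^ (2 * s)
  * (Gamma ((N%:R + 2 * s) / 2) / Gamma (2 - s)) * s * (1 - s).

(* The value 0 given to the kernel on the diagonal is immaterial. *)
Definition gagliardo_kernel (p : 'rV[R]_N * 'rV[R]_N) : R :=
  enorm (p.1 - p.2) `^ (- (N%:R + 2 * s)).

(* [f]_{H^s(A)}^2, without the constant C(N, s) / 2 *)
Definition gagliardo2 A f : \bar R :=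
  (\int[leb2]_(p in A `*` A)
     ((f p.1 - f p.2) ^+ 2 * gagliardo_kernel p)%:E)%E.

Definition hs_norm2 A f : \bar R :=
  (\int[leb]_(x in A) (f x ^+ 2)%:E + gagliardo2 A f)%E.

(* The completion of the test functions for the Gagliardo norm, realized as a
   space of functions: by the Sobolev inequality (2 s < N), a Gagliardo-Cauchy
   sequence of test functions converges in L^(2N/(N-2s)), hence a.e. along a
   subsequence, and the a.e. limit determines the element of the completion.
   A test function on [A] is extended by 0, being defined on the whole space. *)
Definition Ds2 A : set ('rV[R]_N -> R) := [set u : 'rV[R]_N -> R |
  measurable_fun setT u /\
  exists phi : nat -> 'rV[R]_N -> R,
    [/\ forall k, test_function A (phi k),
        gagliardo2 setT (fun x => phi k x - u x) @[k --> \oo] --> 0%E &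
        {ae leb, forall x, phi k x @[k --> \oo] --> u x}]].

Definition Ds2_form u v : R :=
  CNs / 2 *
  \int[leb2]_p ((u p.1 - u p.2) * (v p.1 - v p.2) * gagliardo_kernel p).

Definition dirichlet_eigenspace A (l : R) : set ('rV[R]_N -> R) :=
  [set u : 'rV[R]_N -> R |
  Ds2 A u /\
  forall v, Ds2 A v -> Ds2_form u v = l * \int[leb]_x (u x * v x)].

Definition dirichlet_eigenfunction A (l : R) u : Prop :=
  dirichlet_eigenspace A l u /\ ~ ae_null leb setT u.

Definition dirichlet_eigenvalues A (lam : nat -> R) : Prop :=
  eigenvalue_sequence leb setT (dirichlet_eigenspace A) lam.

Definition cutoff A K zeta : Prop :=
  test_function A zeta /\
  exists U : set 'rV[R]_N, [/\ open U, K `<=` U & forall x, U x -> zeta x = 1].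

(* For [u] in H^s_loc(A) the constraint on [w] does not depend on the cutoff. *)
Definition capacity A K u : \bar R :=
  ereal_inf [set (Ds2_form w w)%:E | w in [set w : 'rV[R]_N -> R | Ds2 A w /\
    exists2 zeta, cutoff A K zeta &
      Ds2 (A `\` K) (fun x => w x - zeta x * u x)]].

End fractional_space.

(* The ambient space of the sphere is ['rV_(N + 1)], the last coordinate of
   [z] being [last_coord z].  Functions on the sphere are represented by
   functions on the ambient space, considered up to [sphere_measure]. *)
Section hemisphere.
Context {R : realType} (N : nat) (s : R).
Implicit Types (f psi phi : 'rV[R]_(N + 1) -> R).
Implicit Types (G : 'rV[R]_(N + 1) -> 'rV[R]_(N + 1)).

Local Notation sigma := (@sphere_measure R (N + 1)).

Definition last_coord (z : 'rV[R]_(N + 1)) : R := z ord0 (rshift N ord0).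
Definition hemisphere : set 'rV[R]_(N + 1) :=
  [set z | enorm z = 1 /\ 0 < last_coord z].
Definition weight (z : 'rV[R]_(N + 1)) : R := last_coord z `^ (1 - 2 * s).

(* tangential part of the gradient of an extension to the ambient space *)
Definition sphere_gradient f : 'rV[R]_(N + 1) -> 'rV[R]_(N + 1) :=
  fun z => gradient f z - dotv (gradient f z) z *: z.

Definition weighted_cvg (phi : nat -> 'rV[R]_(N + 1) -> R) psi G : Prop :=
  (\int[sigma]_(z in hemisphere)
     (weight z * ((phi k z - psi z) ^+ 2
        + enorm (sphere_gradient (phi k) z - G z) ^+ 2))%:E)%E
  @[k --> \oo] --> 0%E.

(* [psi] belongs to the completion of the restrictions of smooth functions
   for the weighted H^1 norm, and [G] is its gradient. *)
Definition weighted_H1 psi G : Prop :=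
  [/\ measurable_fun setT psi, measurable_fun setT G &
      exists2 phi : nat -> 'rV[R]_(N + 1) -> R,
        forall k, smooth (phi k) & weighted_cvg phi psi G].

(* The Neumann condition is the natural one: the test functions do not vanish
   on the equator. *)
Definition hemisphere_eigenspace (l : R) : set ('rV[R]_(N + 1) -> R) :=
  [set psi : 'rV[R]_(N + 1) -> R | exists2 G, weighted_H1 psi G &
    forall phi H, weighted_H1 phi H ->
      \int[sigma]_(z in hemisphere) (weight z * dotv (G z) (H z)) =
      l * \int[sigma]_(z in hemisphere) (weight z * (psi z * phi z))].

Definition hemisphere_eigenvalues (mu : nat -> R) : Prop :=
  eigenvalue_sequence sigma hemisphere hemisphere_eigenspace mu.

Definition equator_embedding (x : 'rV[R]_N) : 'rV[R]_(N + 1) := row_mx x 0.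

(* Trace of [psi] on the equator of the hemisphere, that is, on the unit sphere
   of R^N; it plays the role of [psi (theta, 0)]. *)
Definition equator_trace psi (tau : 'rV[R]_N -> R) : Prop :=
  measurable_fun setT tau /\
  exists (G : 'rV[R]_(N + 1) -> 'rV[R]_(N + 1))
         (phi : nat -> 'rV[R]_(N + 1) -> R),
    [/\ forall k, smooth (phi k), weighted_cvg phi psi G &
        (\int[@sphere_measure R N]_x
           ((phi k (equator_embedding x) - tau x) ^+ 2)%:E)%E
        @[k --> \oo] --> 0%E].

End hemisphere.

(* [eps^(-gamma) u(eps x)] converges to the homogeneous profile [psihat] built
   on the eigenfunction [psi] of the hemisphere with eigenvalue [mu k0]. *)
Definition blowup_profile (R : realType) (N : nat) (s : R)
    (u : 'rV[R]_N -> R) (gamma : R) (psihat : 'rV[R]_N -> R) : Prop :=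
  exists (mu : nat -> R) (k0 : nat) (psi : 'rV[R]_(N + 1) -> R)
         (tau : 'rV[R]_N -> R),
    [/\ hemisphere_eigenvalues N s mu, (1 <= k0)%N,
        hemisphere_eigenspace s (mu k0) psi,
        ~ ae_null (@sphere_measure R (N + 1)) (@hemisphere R N) psi &
        equator_trace s psi tau] /\
    [/\ gamma = - ((N%:R - 2 * s) / 2)
                + Num.sqrt (((N%:R - 2 * s) / 2) ^+ 2 + mu k0),
        psihat = (fun x => enorm x `^ gamma * tau (direction x)),
        forall r, 0 < r ->
          hs_norm2 s (@eball R N r)
            (fun x => eps `^ (- gamma) * u (eps *: x) - psihat x)
          @[eps --> 0^'+] --> 0%E &
        ~ ae_null (lebesgue_rV N) setT psihat].

(* Main.v *)
(* After rescaling x = eps y, the capacity of eps K for u in Omega becomes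
   eps^(N + 2 (gamma - s)) times the capacity of K for
   v_eps = eps^(-gamma) u(eps .) in Omega / eps, so one has to show that the
   latter converges to the capacity of K for psihat in R^N.  Multiplication by
   a test function zeta is bounded from H^s of a ball containing its support to
   the Gagliardo norm, hence zeta v_eps -> zeta psihat in D^{s,2}.
   - Upper bound: take w almost optimal for psihat, with cutoff zeta, and a test
     function phi supported off K and close to w - zeta psihat; then
     phi + zeta v_eps is admissible in Omega / eps once this set contains both
     supports.
   - Lower bound: if w is admissible in Omega / eps, then
     w + zeta (psihat - v_eps) is admissible in R^N for a fixed cutoff zeta.
   No compactness is needed: both competitors differ from w by a function of
   small norm.  The Sobolev inequality is replaced by an elementary Poincare
   inequality, as v_eps lives in a bounded set. *)
Require Import Defs.
From HB Require Import structures.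
From mathcomp Require Import all_boot all_order all_algebra.
From mathcomp Require Import all_classical all_reals all_analysis.
From mathcomp Require Import measurable_realfun ring lra.

Import Order.TTheory GRing.Theory Num.Theory.
Import numFieldNormedType.Exports.

Local Open Scope classical_set_scope.
Local Open Scope ring_scope.

Set Implicit Arguments.
Unset Strict Implicit.
Unset Printing Implicit Defensive.

(** * Borel measurability and changes of variables in R^n *)

(** The delicate point is membership in [Ds2]: one and the same sequence of test functions must
    converge in the Gagliardo seminorm, which is blind to constants, and almost everywhere. Products
    with a cutoff are therefore approximated in seminorm at a geometric rate inside a ball; there
    the Poincare inequality makes the squared L^2 errors summable, and almost everywhere convergence
    follows. The profile is known only through local convergence, so its product with a cutoff
    enters the space as such a limit. The cutoff estimate itself rests on the integrability of
    min(1, |z|^2) |z|^(-N-2s), where 0 < s controls infinity and s < 1 the origin. Energies are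
    compared through (a + b)^2 <= (1 + t) a^2 + (1 + 1/t) b^2: t is chosen first, to absorb the
    energy of the main competitor, and the perturbation is then made small against 1/t. In the lower
    bound the competitor varies with eps, and the upper bound supplies the uniform energy bound from
    which t is chosen. *)

Section rV_open.
Context {R : realType} {n : nat}.

(** The sigma-algebra is generated by the coordinates, so an open set has to be rewritten as a
    countable union of coordinate boxes, here with rational centres and radii 1/(k+1). *)
Lemma open_measurable_rV (O : set 'rV[R]_n) : open O -> measurable O.
Proof.
move=> oO.
pose box (p : 'rV[rat]_n * nat) : set 'rV[R]_n :=
  [set y | forall i, `|ratr (p.1 ord0 i) - y ord0 i| < p.2.+1%:R^-1].
pose F p : set 'rV[R]_n := if `[< box p `<=` O >] then box p else set0.
have -> : O = \bigcup_p F p.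
  apply/seteqP; split=> [x Ox|x [p _]]; last first.
    by rewrite /F; case: asboolP => // pO /pO.
  (* The radius is taken below e/2 because a point of the box reaches [x] through the rational
     centre, at the cost of two radii. *)
  have /nbhs_ballP[e /= e0 eO] := open_nbhs_nbhs (conj oO Ox).
  have [k ke] : exists k : nat, k.+1%:R^-1 < e / 2.
    have /cvgr0Pnorm_lt /(_ (e / 2)) := @cvg_harmonic R.
    rewrite divr_gt0// => /(_ isT)[k _ /(_ k (leqnn k))] /=.
    by rewrite gtr0_norm ?invr_gt0//; exists k.
  have qx i : exists q : rat, `|ratr q - x ord0 i| < k.+1%:R^-1.
    have [] := @dense_rat R (ball (x ord0 i) k.+1%:R^-1).
    - by exists (x ord0 i); exact: ballxx.
    - exact: ball_open.
    - by move=> y [xy [q _ qy]]; exists q; move: xy; rewrite -qy /ball/= distrC.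
  have [q qP] := choice qx.
  exists (\row_i q i, k) => //; rewrite /F; case: asboolP; last first.
    case=> y /= yb; apply: eO; split=> // i j; rewrite ord1 /ball/=.
    rewrite -(subrK (ratr (q j)) (x _ _)) -addrA (le_lt_trans (ler_normD _
      _))//.
    rewrite distrC (splitr e) ltrD// ?(lt_trans (qP j))//.
    by have := yb j; rewrite mxE => /lt_trans; exact.
  by move=> _ i /=; rewrite mxE.
apply: countable_bigcupT_measurable => [|p]; first exact: countableP.
rewrite /F; case: ifPn => // _.
have -> : box p = \bigcap_(i in [set: 'I_n])
    ((fun y : 'rV[R]_n => y ord0 i) @^-1` ball (ratr (p.1 ord0 i) : R)
      p.2.+1%:R^-1).
  by apply/seteqP; split => y /= yb i; [move=> _|]; exact: yb.
apply: fin_bigcap_measurable => // i _.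
rewrite -[X in measurable X]setTI; apply: (measurable_coord) => //.
exact: measurable_ball.
Qed.

Lemma continuous_measurable_rV (f : 'rV[R]_n -> R) :
  continuous f -> measurable_fun setT f.
Proof.
move=> cf; apply: (measurability _ (RGenOpens.measurableE R)) => /= _ [_ [a [b
  ->]] <-].
rewrite setTI; apply: open_measurable_rV.
by move/continuousP : cf; apply; exact: interval_open.
Qed.

End rV_open.

Section lebesgue_affine.
Context {R : realType}.
Local Open Scope ereal_scope.

(** Uniqueness of Lebesgue measure: [c] times its image under t -> c t + b gives intervals their
    length, hence is Lebesgue measure itself. *)
Lemma ge0_integral_lebesgue_affine (f : R -> \bar R) (c b : R) :
  (0 < c)%R -> measurable_fun setT f -> (forall t, 0 <= f t) ->
  \int[lebesgue_measure]_t f (c * t + b)%R =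
  c^-1%:E * \int[lebesgue_measure]_t f t.
Proof.
move=> c0 mf f0.
pose phi (t : measurableTypeR R) : measurableTypeR R := (c * t + b)%R.
have mphi : measurable_fun setT phi.
  by apply: measurable_funD => //; exact: measurable_funM.
pose mu := [the {measure set (measurableTypeR R) -> \bar R} of
  mscale (NngNum (ltW c0))
   (measure_function_pushforward__canonical__measure_function_Measure
      (@lebesgue_measure R) mphi)].
have muE : \int[lebesgue_measure]_t f t = \int[mu]_t f t.
  apply: eq_measure_integral => A mA _.
  apply: lebesgue_measure_unique => // _ [[x y] _ <-].
  rewrite /mu/= /mscale/= /pushforward.
  have -> : phi @^-1` `]x, y]%classic = `]((x - b) / c)%R, ((y - b) /
    c)%R]%classic.
    apply/seteqP; split => t /=; rewrite !in_itv/= /phi.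
      by rewrite ltr_pdivrMr// ler_pdivlMr// ltrBlDr lerBrDr [(t * c)%R]mulrC.
    by rewrite ltr_pdivrMr// ler_pdivlMr// ltrBlDr lerBrDr [(t * c)%R]mulrC.
  rewrite !lebesgue_measure_itv/= !lte_fin ltr_pM2r ?invr_gt0// ltrD2r.
  case: ifPn => _; last by rewrite mule0.
  by rewrite -!EFinB -EFinM; congr EFin; field; rewrite gt_eqF.
rewrite muE ge0_integral_mscale//=.
rewrite ge0_integral_pushforward//= muleA -EFinM mulVf ?gt_eqF// mul1e.
by [].
Qed.

Lemma integral_lebesgue_rVS n (f : 'rV[R]_n.+1 -> \bar R) :
  measurable_fun setT f -> (forall x, 0 <= f x) ->
  \int[lebesgue_rV n.+1]_x f x =
  \int[lebesgue_measure]_t \int[lebesgue_rV n]_y f (rV_cons (t, y)).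
Proof.
move=> mf f0.
pose mu : {measure set 'rV[R]_n.+1 -> \bar R} :=
  measure_function_pushforward__canonical__measure_function_Measure
    (@lebesgue_measure R \x lebesgue_rV n) (@measurable_rV_cons R n).
rewrite (eq_measure_integral mu) => [|A mA _]; last by [].
rewrite (ge0_integral_pushforward (@measurable_rV_cons R n))//= preimage_setT.
rewrite (fubini_tonelli1 (f \o @rV_cons R n))//=.
exact: measurableT_comp (@measurable_rV_cons R n).
Qed.

Lemma measurable_affine n (c : R) (b : 'rV[R]_n) :
  measurable_fun setT (fun x : 'rV[R]_n => c *: x + b)%R.
Proof.
apply/measurable_fun_rVP => i; under eq_fun do rewrite !mxE.
by apply: measurable_funD => //; apply: measurable_funM => //;
  exact: measurable_coord.
Qed.

(** Induction on the dimension: the map acts separately on the first coordinate and on the others,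
    so Tonelli yields one factor 1/c per coordinate. In dimension 0 the measure is a Dirac mass. *)
Lemma ge0_integral_rV_affine n (f : 'rV[R]_n -> \bar R) (c : R) (b : 'rV[R]_n) :
  (0 < c)%R -> measurable_fun setT f -> (forall x, 0 <= f x) ->
  \int[lebesgue_rV n]_x f (c *: x + b)%R =
  (c ^- n)%:E * \int[lebesgue_rV n]_x f x.
Proof.
move=> c0; elim: n f b => [|n IH] f b mf f0.
  rewrite expr0 invr1 mul1e; apply: eq_integral => x _.
  by congr f; apply/rowP => -[].
have consE (t : R) (y : 'rV[R]_n) : (c *: rV_cons (t, y) + b)%R =
    rV_cons (c * t + b ord0 ord0, c *: y + \row_i b ord0 (lift ord0 i))%R.
  apply/rowP => i; rewrite !mxE /rV_cons.
  case: (@split_ordP 1 n i) => k ->.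
    by rewrite !mxE [k]ord1/= !mulr1n; congr (_ + b _ _)%R; apply/val_inj.
  by rewrite !mxE/=; congr (_ + b _ _)%R; apply/val_inj.
have mfc := measurableT_comp mf (@measurable_rV_cons R n).
have mF := @measurable_fun_fubini_tonelli_F _ _ _ _ _ (lebesgue_rV n) _ mfc
  (fun=> f0 _).
rewrite !integral_lebesgue_rVS//; last first.
  exact: measurableT_comp mf (@measurable_affine _ _ _).
under eq_integral => t _.
  under eq_integral do rewrite consE.
  rewrite (IH (fun y => f (rV_cons (c * t + b ord0 ord0, y)%R)))//; last first.
    exact: (measurable_fun_pair2 _ mfc).
  over.
have cn0 : (0 <= c ^- n)%R by rewrite invr_ge0 exprn_ge0// ltW.
pose G (t : R) := fubini_F (lebesgue_rV n) (f \o @rV_cons R n) t.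
have G0 t : 0 <= G t by apply: integral_ge0 => y _; exact: f0.
transitivity (\int[lebesgue_measure]_t ((c ^- n)%:E * G (c * t + b ord0
  ord0)%R)).
  by [].
etransitivity; first apply: ge0_integralZl_EFin => //.
  apply: (measurableT_comp (f := G) mF).
  by apply: measurable_funD => //; exact: measurable_funM.
by rewrite (@ge0_integral_lebesgue_affine G)// muleA -EFinM exprSr invfM.
Qed.

End lebesgue_affine.

(** * Smooth functions and cutoffs *)

Section smooth_closure.
Context {R : realType} {n : nat}.
Implicit Types f g : 'rV[R]_n -> R.

Lemma smooth_differentiable f x : smooth f -> differentiable f x.
Proof. by move=> /(_ [::]). Qed.

Lemma smooth_partial f i : smooth f -> smooth (partial i f).
Proof. by move=> sf l x; have := sf (rcons l i) x; rewrite foldr_rcons. Qed.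

(** A derivative of a product is a sum of products, so an induction over iterated derivatives needs
    an invariant that contains all of these at once. *)
Inductive algebra_closure (B : set ('rV[R]_n -> R)) : ('rV[R]_n -> R) -> Prop :=
| AC_base f : B f -> algebra_closure B f
| AC_add f g : algebra_closure B f -> algebra_closure B g ->
    algebra_closure B (f + g)
| AC_mul f g : algebra_closure B f -> algebra_closure B g ->
    algebra_closure B (f * g).

(* The generated algebra is stable under partial derivatives by the Leibniz
   rule, so all its elements are smooth. *)
Lemma smooth_algebra_closure (B : set ('rV[R]_n -> R)) f :
  (forall g x, B g -> differentiable g x) ->
  (forall g i, B g -> algebra_closure B (partial i g)) ->
  algebra_closure B f -> smooth f.
Proof.
move=> dB pB Bf.
have dAC g x : algebra_closure B g -> differentiable g x.
  elim=> {g} [g|g h _ dg _ dh|g h _ dg _ dh]; first exact: dB.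
  - exact: differentiableD.
  - exact: differentiableM.
have pAC g i : algebra_closure B g -> algebra_closure B (partial i g).
  elim=> {g} [g|g h Bg pg Bh ph|g h Bg pg Bh ph]; first exact: pB.
  - have -> : partial i (g + h) = partial i g + partial i h.
      apply/funext => x; rewrite /partial deriveD//; apply: diff_derivable;
      exact: dAC.
    exact: AC_add.
  - have -> : partial i (g * h) = g * partial i h + h * partial i g.
      apply/funext => x; rewrite /partial deriveM//; apply: diff_derivable;
      exact: dAC.
    by apply: AC_add; exact: AC_mul.
move=> l x; apply: dAC; elim: l => //= i l; exact: pAC.
Qed.

Lemma smoothD f g : smooth f -> smooth g -> smooth (fun x => f x + g x).
Proof.
move=> sf sg; refine (@smooth_algebra_closure (@smooth R n) (f + g) _ _ _);
  last 1 first.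
- by apply: AC_add; exact: AC_base.
- by move=> h x; exact: smooth_differentiable.
- by move=> h i sh; apply: AC_base; exact: smooth_partial.
Qed.

Lemma smoothM f g : smooth f -> smooth g -> smooth (fun x => f x * g x).
Proof.
move=> sf sg; refine (@smooth_algebra_closure (@smooth R n) (f * g) _ _ _);
  last 1 first.
- by apply: AC_mul; exact: AC_base.
- by move=> h x; exact: smooth_differentiable.
- by move=> h i sh; apply: AC_base; exact: smooth_partial.
Qed.

Lemma smooth_cst (a : R) : smooth (fun _ : 'rV[R]_n => a).
Proof.
refine (@smooth_algebra_closure [set f | exists b : R, f = cst b] (cst a) _ _
  _).
- by move=> g x [b ->]; exact: differentiable_cst.
- move=> g i [b ->]; apply: AC_base; exists 0.
  by apply/funext => x; rewrite /partial derive_cst.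
- by apply: AC_base; exists a.
Qed.

Lemma smoothZ (a : R) f : smooth f -> smooth (fun x => a * f x).
Proof. by apply: smoothM; exact: smooth_cst. Qed.

Lemma smoothB f g : smooth f -> smooth g -> smooth (fun x => f x - g x).
Proof.
move=> sf sg; rewrite (_ : (fun _ => _) = (fun x => f x + -1 * g x)).
  by apply: smoothD => //; exact: smoothZ.
by apply/funext => x; rewrite mulN1r.
Qed.

Lemma smooth_coord (i : 'I_n) : smooth (fun x : 'rV[R]_n => x ord0 i).
Proof.
refine (@smooth_algebra_closure
  [set f | smooth f \/ f = (fun x : 'rV[R]_n => x ord0 i)] (fun x => x ord0 i)
    _ _ _).
- move=> g x [sg|->]; first exact: smooth_differentiable.
  exact: differentiable_coord.
- move=> g k [sg|->]; first by apply: AC_base; left; exact: smooth_partial.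
  apply: AC_base; left.
  have -> : partial k (fun x : 'rV[R]_n => x ord0 i) =
      cst ((delta_mx ord0 k : 'rV[R]_n) ord0 i); last exact: smooth_cst.
  apply/funext => x; rewrite /partial deriveE; last exact: differentiable_coord.
  have @l : {linear 'rV[R]_n -> R}.
    by exists (fun y : 'rV[R]_n => y ord0 i); do 2![eexists]; do ?[constructor];
      rewrite ?mxE// => ? *; rewrite ?mxE//; move=> ?; rewrite !mxE.
  rewrite (_ : (fun y : 'rV[R]_n => y ord0 i) = l)// diff_lin//.
  exact: coord_continuous.
- by apply: AC_base; right.
Qed.

Lemma smooth_sum (I : Type) (r : seq I) (f : I -> 'rV[R]_n -> R) :
  (forall i, smooth (f i)) -> smooth (fun x => \sum_(i <- r) f i x).
Proof.
move=> sf; elim: r => [|i r IH].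
  by under eq_fun do rewrite big_nil; exact: smooth_cst.
by under eq_fun do rewrite big_cons; exact: smoothD.
Qed.

Lemma smooth_dotv : smooth (fun x : 'rV[R]_n => dotv x x).
Proof. by apply: smooth_sum => i; apply: smoothM; exact: smooth_coord. Qed.

(** The outer function comes with its whole tower of derivatives [F k]; the chain rule turns
    [F k \o f] into [F k.+1 \o f] times a smooth factor, which stays in the generated algebra. *)
Lemma smooth_comp (F : nat -> R -> R) f :
  (forall k (t : R), is_derive t 1 (F k) (F k.+1 t)) -> smooth f ->
  smooth (fun x => F 0%N (f x)).
Proof.
move=> dF sf.
have diffF k t : differentiable (F k) t.
  by apply/derivable1_diffP; have [] := dF k t.
refine (@smooth_algebra_closure
  [set g | smooth g \/ exists k, g = F k \o f] (F 0%N \o f) _ _ _).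
- move=> g x [sg|[k ->]]; first exact: smooth_differentiable.
  by apply: differentiable_comp => //; exact: smooth_differentiable.
- move=> g i [sg|[k ->]]; first by apply: AC_base; left; exact: smooth_partial.
  have -> : partial i (F k \o f) = (F k.+1 \o f) * partial i f.
    apply/funext => x; have df := smooth_differentiable x sf.
    rewrite /partial !deriveE//; last exact: (differentiable_comp df (diffF k
      _)).
    rewrite diff_comp//= deriv1E/=; last exact/derivable1_diffP.
    by rewrite derive1E; have [_ ->] := dF k (f x); rewrite -deriveE//;
      exact: mulrC.
  by apply: AC_mul; apply: AC_base; [right; exists k.+1|left;
    exact: smooth_partial].
- by apply: AC_base; right; exists 0%N.
Qed.

Lemma smooth_scale (c : R) f : smooth f -> smooth (fun x => f (c *: x)).
Proof.
move=> sf.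
have dc x : differentiable ( *:%R c : 'rV[R]_n -> 'rV[R]_n) x.
  by apply: linear_differentiable; exact: scaler_continuous.
refine (@smooth_algebra_closure
  [set g | exists2 h, smooth h & g = h \o *:%R c] (f \o *:%R c) _ _ _);
    last 1 first.
- by apply: AC_base; exists f.
- move=> g x [h sh ->].
  by apply: differentiable_comp => //; exact: smooth_differentiable.
- move=> g i [h sh ->]; apply: AC_base.
  exists (fun x => c * partial i h x); first exact/smoothZ/smooth_partial.
  apply/funext => x; have dh y := smooth_differentiable y sh.
  rewrite /partial !deriveE//=; last exact: differentiable_comp.
  have [_ dcE] := is_diff_scaler c x.
  by rewrite diff_comp//= dcE linearZ -deriveE.
Qed.

End smooth_closure.

(** * A smooth step function built from exp(-1/t) *)

Section bump.
Context {R : realType}.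
Implicit Types (P : {poly R}) (t : R).

(** For k > 0, exp(y) = exp(y/k)^k >= (y/k)^k. For k = 0 the bound reads exp(-y) <= 1, with 0^0 =
    1. *)
Lemma exprn_expRN_le (k : nat) (y : R) : 0 < y -> y ^+ k * expR (- y) <= k%:R
  ^+ k.
Proof.
move=> y0; rewrite expRN ler_pdivrMr ?expR_gt0//.
case: k => [|k]; first by rewrite !expr0 mul1r (le_trans _ (expR_ge1Dx y))//
  lerDl ltW.
have k0 : 0 < k.+1%:R :> R by rewrite ltr0n.
have -> : expR y = expR (y / k.+1%:R) ^+ k.+1.
  by rewrite -expRM_natl mulrC divfK ?gt_eqF.
rewrite -exprMn; apply: lerXn2r; rewrite ?nnegrE.
- exact: ltW.
- by rewrite mulr_ge0// ?expR_ge0 ?ltW.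
- rewrite -ler_pdivrMl// mulrC.
  by rewrite (le_trans _ (expR_ge1Dx _))// lerDr.
Qed.

Lemma horner_expRN_le P :
  exists2 C : R, 0 <= C & forall y, 0 < y -> `|P.[y]| * expR (- y) <= C.
Proof.
exists (\sum_(i < size P) `|P`_i| * i%:R ^+ i).
  by apply: sumr_ge0 => i _; rewrite mulr_ge0// exprn_ge0.
move=> y y0; rewrite horner_coef.
apply: (@le_trans _ _ (\sum_(i < size P) `|P`_i * y ^+ i| * expR (- y))).
  by rewrite -mulr_suml ler_wpM2r ?expR_ge0// ler_norm_sum.
apply: ler_sum => i _; rewrite normrM -mulrA ler_wpM2l//.
rewrite (ger0_norm (exprn_ge0 _ (ltW y0))); exact: exprn_expRN_le.
Qed.

(** The polynomial parameter makes the family stable under differentiation: the derivatives of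
    exp(-1/t) are again of this form. *)
Definition flat P t : R := if 0 < t then P.[t^-1] * expR (- t^-1) else 0.

(** For t > 0, differentiating P(1/t) exp(-1/t) brings out the factor t^-2, whence the polynomial
    X^2 (P - P'). At 0 the difference quotient is h times a bounded quantity. *)
Lemma is_derive_flat P t :
  is_derive t 1 (flat P) (flat ('X^2 * (P - P^`())) t).
Proof.
have [t0|t0|<-] := ltgtP 0 t.
- have dV := @is_deriveV R id t 1 1 (lt0r_neq0 t0) (is_derive_id _ _).
  have dP := is_derive1_comp (is_derive_poly P t^-1) dV.
  have dE := is_derive1_comp (f := expR) (g := fun x => - x^-1) (is_derive_expR
    (- t^-1)) (is_deriveN dV).
  have dPE := is_deriveM dP dE.
  have {}dPE : is_derive t (1 : R) (fun x => P.[x^-1] * expR (- x^-1)) _ := dPE.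
  have {}dPE := is_derive_eq dPE (_ : _ = flat ('X^2 * (P - P^`())) t).
  apply: (near_eq_is_derive _ (dPE _)); last first.
    rewrite /flat t0 !hornerE /GRing.scale/=; field.
    by rewrite gt_eqF.
  near=> x; rewrite /flat.
  suff -> : 0 < x by [].
  by near: x; exact: lt_nbhsr.
- rewrite {2}/flat ltNge (ltW t0)/=.
  apply: near_eq_is_derive (is_derive_cst _ _ _); near=> x.
  rewrite /flat ltNge; suff -> : x <= 0 by [].
  apply: ltW; near: x; exact: lt_nbhsl.
(* The bound is taken for X^2 P and not for P: one factor 1/h is spent on the difference quotient,
   the other leaves a factor h that tends to 0. *)
- have [C C0 CP] := horner_expRN_le ('X^2 * P).
  have C1 : 0 < C + 1 by rewrite ltr_wpDl.
  have flat0 Q : flat Q 0 = 0 by rewrite /flat ltxx.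
  rewrite flat0.
  have cv : h^-1 *: ((flat P \o shift 0) (h *: (1 : R)) - flat P 0) @[h -->
    0^'] --> (0 : R).
    apply/cvgr0Pnorm_le => e e0; near=> h.
    have h0 : h != 0 by near: h; exact: nbhs_dnbhs_neq.
    rewrite /= flat0 subr0 addr0 /GRing.scale/= mulr1 normrM normfV.
    have [hp|hn] := ltP 0 h; last first.
      by rewrite /flat ltNge hn/= normr0 mulr0 ltW.
    rewrite /flat hp normrM (ger0_norm (expR_ge0 _)) (gtr0_norm hp).
    have hV : 0 < h^-1 by rewrite invr_gt0.
    have := CP _ hV; rewrite hornerM hornerXn normrM (ger0_norm (exprn_ge0 _
      (ltW hV))).
    rewrite -mulrA => Ch.
    have -> : h^-1 * (`|P.[h^-1]| * expR (- h^-1)) =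
      h * (h^-1 ^+ 2 * (`|P.[h^-1]| * expR (- h^-1))) by field; rewrite gt_eqF.
    apply: (le_trans (ler_wpM2l (ltW hp) Ch)).
    rewrite (@le_trans _ _ (h * (C + 1)))//.
      by rewrite ler_wpM2l ?lerDl// ltW.
    rewrite -ler_pdivlMr//.
    rewrite (le_trans (ler_norm _))//.
    near: h; apply: dnbhs0_le; exact: divr_gt0.
  by apply: DeriveDef; [apply/cvg_ex; exists 0|exact/cvg_lim].
Unshelve. all: by end_near.
Qed.

(* The plateau is obtained by composition: [flat 1] is constant on the negative
   half-line, so no quotient is needed. *)
Definition step t : R := flat 1 (flat 1 1 - flat 1 t) / flat 1 (flat 1 1).

Lemma flat1_gt0 t : 0 < t -> 0 < flat 1 t.
Proof. by move=> t0; rewrite /flat t0 hornerC mul1r expR_gt0. Qed.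

Lemma flat_le0 P t : t <= 0 -> flat P t = 0.
Proof. by move=> t0; rewrite /flat ltNge t0. Qed.

Lemma step_le0 t : t <= 0 -> step t = 1.
Proof.
move=> t0; rewrite /step (flat_le0 1 t0) subr0 divff// gt_eqF//.
by rewrite !flat1_gt0.
Qed.

Lemma step_ge1 t : 1 <= t -> step t = 0.
Proof.
move=> t1; have t0 : 0 < t by apply: lt_le_trans t1.
rewrite /step (@flat_le0 1 (flat 1 1 - flat 1 t)) ?mul0r//.
rewrite subr_le0 /flat ltr01 t0 !hornerC !mul1r ler_expR lerN2 invr1.
by rewrite invf_le1.
Qed.

Lemma smooth_flat n (f : 'rV[R]_n -> R) : smooth f -> smooth (fun x => flat 1
  (f x)).
Proof.
pose F k := flat (iter k (fun P => 'X^2 * (P - P^`())) 1).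
by apply: (smooth_comp (F := F)) => k t; exact: is_derive_flat.
Qed.

Lemma smooth_step n (f : 'rV[R]_n -> R) : smooth f -> smooth (fun x => step (f
  x)).
Proof.
move=> sf; apply: smoothM; last exact: smooth_cst.
by apply: smooth_flat; apply: smoothB; [exact: smooth_cst|exact: smooth_flat].
Qed.

End bump.

(** * Test functions *)

Section enorm_theory.
Context {R : realType} {n : nat}.
Implicit Types x y : 'rV[R]_n.

Lemma enorm_ge0 x : 0 <= enorm x.
Proof. exact: sqrtr_ge0. Qed.

Lemma dotvv_ge0 x : 0 <= dotv x x.
Proof. by apply: sumr_ge0 => i _; exact: sqr_ge0. Qed.

Lemma sqr_enorm x : enorm x ^+ 2 = dotv x x.
Proof. by rewrite sqr_sqrtr// dotvv_ge0. Qed.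

Lemma normr_coord_le x i : `|x ord0 i| <= enorm x.
Proof.
rewrite -sqrtr_sqr ler_sqrt ?dotvv_ge0// /dotv (bigD1 i)//= expr2 lerDl.
by apply: sumr_ge0 => k _; exact: sqr_ge0.
Qed.

Lemma normr_coord_le_norm x i : `|x ord0 i| <= `|x|.
Proof.
by rewrite [`|x|]mx_normrE (bigD1 (ord0, i))//= le_max lexx.
Qed.

Lemma norm_le_enorm x : `|x| <= enorm x.
Proof.
rewrite [`|x|]mx_normrE; elim/big_ind: _ => //; first exact: enorm_ge0.
  by move=> a b ? ?; rewrite ge_max; apply/andP.
by move=> [i j] _ /=; rewrite ord1 normr_coord_le.
Qed.

Lemma enorm_le_norm x : enorm x <= n%:R * `|x|.
Proof.
rewrite -[leRHS]ger0_norm ?mulr_ge0// -sqrtr_sqr ler_sqrt ?sqr_ge0//.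
apply: (@le_trans _ _ (\sum_(i < n) `|x| ^+ 2)).
  apply: ler_sum => i _; rewrite -expr2 -real_normK ?num_real//.
  by rewrite lerXn2r ?nnegrE ?normr_coord_le_norm.
rewrite sumr_const card_ord -[(`|x| ^+ 2) *+ n]mulr_natl exprMn ler_wpM2r
  ?sqr_ge0//.
by rewrite -natrX ler_nat; case: (n) => // k; rewrite leq_pmulr.
Qed.

Lemma enormZ (c : R) x : enorm (c *: x) = `|c| * enorm x.
Proof.
rewrite -sqrtr_sqr -sqrtrM ?sqr_ge0//; congr Num.sqrt.
rewrite /dotv mulr_sumr; apply: eq_bigr => i _; rewrite !mxE.
by rewrite mulrACA -expr2.
Qed.

Lemma enormN x : enorm (- x) = enorm x.
Proof. by rewrite -scaleN1r enormZ normrN1 mul1r. Qed.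

End enorm_theory.

Section test_functions.
Context {R : realType} {n : nat}.
Implicit Types (f g zeta : 'rV[R]_n -> R) (A B : set 'rV[R]_n).

Lemma smooth_continuous f : smooth f -> continuous f.
Proof.
by move=> sf x; apply: differentiable_continuous; exact: smooth_differentiable.
Qed.

Lemma smooth_measurable f : smooth f -> measurable_fun setT f.
Proof. by move=> /smooth_continuous; exact: continuous_measurable_rV. Qed.

Lemma test_function_support A f x : test_function A f -> f x != 0 -> A x.
Proof. by move=> [_ _ fA] fx; apply: fA; exact: subset_closure. Qed.

Lemma test_function_sub A B f g : smooth g ->
  (forall x, g x != 0 -> f x != 0) -> test_function A f -> 
  closure [set x | f x != 0] `<=` B -> test_function B g.
Proof.
move=> sg gf [_ cf fA] fB.
have gfS : closure [set x | g x != 0] `<=` closure [set x | f x != 0].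
  by apply: closure_subset => x; exact: gf.
split=> //; last exact: (subset_trans gfS).
by apply: (subclosed_compact _ cf gfS); exact: closed_closure.
Qed.

Lemma test_function_subset A B f : A `<=` B ->
  test_function A f -> test_function B f.
Proof. by move=> AB [sf cf fA]; split=> //; exact: subset_trans AB. Qed.

Lemma test_function0 A : test_function A (fun _ : 'rV[R]_n => 0 : R).
Proof.
have -> : (fun _ : 'rV[R]_n => 0 : R) = cst 0 by [].
suff -> : test_function A (cst 0 : 'rV[R]_n -> R) =
  [/\ smooth (cst 0 : 'rV[R]_n -> R), compact (closure (@set0 'rV[R]_n)) &
    closure set0 `<=` A].
  by rewrite closure0; split; [exact: smooth_cst|exact: compact0|].
rewrite /test_function; congr ([/\ _, compact (closure _) & closure _ `<=` A]);
  by apply/seteqP; split=> x //=; rewrite eqxx.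
Qed.

Lemma test_functionD A f g : test_function A f -> test_function A g ->
  test_function A (fun x => f x + g x).
Proof.
move=> [sf cf fA] [sg cg gA].
have S : closure [set x | f x + g x != 0] `<=`
    closure [set x | f x != 0] `|` closure [set x | g x != 0].
  rewrite -closureU; apply: closure_subset => x /= fg0.
  case: (eqVneq (f x) 0) => [fx|]; last by left.
  by right; move: fg0; rewrite fx add0r.
split; first exact: smoothD.
- apply: (subclosed_compact _ (compactU cf cg) S); exact: closed_closure.
- by apply: (subset_trans S) => x [/fA|/gA].
Qed.

Lemma test_functionZ A (c : R) f : test_function A f ->
  test_function A (fun x => c * f x).
Proof.
move=> tf; have [sf _ fA] := tf; apply: (test_function_sub _ _ tf fA).
  exact: smoothZ.
by move=> x; rewrite mulf_eq0 negb_or => /andP[].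
Qed.

Lemma test_functionB A f g : test_function A f -> test_function A g ->
  test_function A (fun x => f x - g x).
Proof.
move=> tf tg; rewrite (_ : (fun _ => _) = (fun x => f x + -1 * g x)).
  by apply: test_functionD => //; exact: test_functionZ.
by apply/funext => x; rewrite mulN1r.
Qed.

Lemma test_function_partial A f i : test_function A f ->
  test_function A (partial i f).
Proof.
move=> [sf cf fA].
have S : closure [set x | partial i f x != 0] `<=` closure [set x | f x != 0].
  suff {}S : [set x | partial i f x != 0] `<=` closure [set x | f x != 0].
    apply: (subset_trans (closure_subset S)).
    by have /closure_id <- := @closed_closure _ [set x | f x != 0].
  move=> x /=; apply: contra_neqP => xf.
  have oC : open (~` closure [set x | f x != 0]) by
    exact/closed_openC/closed_closure.
  rewrite /partial (near_eq_derive (g := cst 0)) ?derive_cst//.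
  have := open_nbhs_nbhs (conj oC xf); apply: filterS => y /= yf.
  by apply/eqP; apply: contra_notT yf => yf; exact: subset_closure.
split; first exact: smooth_partial.
- by apply: (subclosed_compact _ cf S); exact: closed_closure.
- exact: subset_trans S fA.
Qed.

Lemma test_function_bounded A f : test_function A f ->
  exists2 M : R, 0 < M & forall x, `|f x| <= M.
Proof.
move=> [sf cf fA].
have /compact_bounded[M [Mr fM]] : compact (f @` closure [set x | f x != 0]).
  apply: continuous_compact cf; apply: continuous_subspaceT.
  exact: smooth_continuous.
exists (`|M| + 1); first by rewrite ltr_wpDl.
move=> x; have [->|fx] := eqVneq (f x) 0; first by rewrite normr0 addr_ge0.
apply: fM; first by rewrite (le_lt_trans (ler_norm _))// ltrDl.
by exists x => //; exact: subset_closure.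
Qed.

Lemma test_function_bounded_support A f : test_function A f ->
  exists2 r : R, 0 < r & closure [set x | f x != 0] `<=` eball r.
Proof.
move=> [sf /compact_bounded[M [Mr fM]] fA].
exists (n%:R * (`|M| + 1) + 1); first by rewrite ltr_wpDl// mulr_ge0// addr_ge0.
move=> x fx; rewrite /eball/=; rewrite (le_lt_trans (enorm_le_norm _))//.
rewrite ltr_pwDr// ler_wpM2l//; apply: fM => //.
by rewrite (le_lt_trans (ler_norm _))// ltrDl.
Qed.

Lemma derive_coords f x (v : 'rV[R]_n) : differentiable f x ->
  'D_v f x = \sum_i v ord0 i * partial i f x.
Proof.
move=> df; rewrite deriveE// {1}(row_sum_delta v) linear_sum.
by apply: eq_bigr => i _; rewrite linearZ /partial deriveE.
Qed.

Lemma is_derive_line f x (v : 'rV[R]_n) (t : R) : differentiable f (t *: v + x)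
  ->
  is_derive t 1 (fun t : R => f (t *: v + x)) ('D_v f (t *: v + x)).
Proof.
move=> df.
have := is_diffD (is_diff_scalel t v) (is_diff_cst x t).
rewrite addr0 => -[dg dgE].
have dfg : differentiable (f \o (fun t : R => t *: v + x)) t.
  exact: differentiable_comp.
apply: DeriveDef; first exact/diff_derivable.
rewrite deriveE// (diff_comp dg df)/= deriveE//.
by rewrite [X in 'd f _ X](_ : _ = v)// dgE scale1r.
Qed.

(** The sup bound and the mean value theorem along the segment give the two branches of the minimum;
    in this form the bound tames the Gagliardo kernel both at the diagonal and at infinity. *)
Lemma test_function_lipschitz A f : test_function A f ->
  exists2 M : R, 0 < M &
    forall x y, (f x - f y) ^+ 2 <= M * Num.min 1 (enorm (x - y) ^+ 2).
Proof.
move=> tf; have [M0 M00 fM0] := test_function_bounded tf.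
have /choice[L LP] : forall i, exists L : R, 0 < L /\ forall x, `|partial i f
  x| <= L.
  by move=> i; have [L L0 LP] := test_function_bounded (test_function_partial i
    tf); exists L.
pose Ls := \sum_i L i.
have Ls0 : 0 <= Ls by apply: sumr_ge0 => i _; rewrite ltW// (LP i).1.
have [sf _ _] := tf.
have lip x y : `|f x - f y| <= Ls * enorm (x - y).
  pose g (t : R) := f (t *: (x - y) + y).
  have dg (t : R) : is_derive t 1 g ('D_(x - y) f (t *: (x - y) + y)).
    by apply: is_derive_line; exact: smooth_differentiable.
  have cg : {within `[0, 1], continuous g}.
    apply: continuous_subspaceT => t; apply: differentiable_continuous.
    by apply/derivable1_diffP; have [] := dg t.
  have [c _] := MVT (@ltr01 R) (fun t _ => dg t) cg.
  rewrite /g scale1r subrK scale0r add0r subr0 mulr1 => ->.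
  rewrite derive_coords; last exact: smooth_differentiable.
  rewrite (le_trans (ler_norm_sum _ _ _))// mulr_suml ler_sum// => i _.
  by rewrite normrM mulrC ler_pM// ?(LP i).2// normr_coord_le.
(* The sum of the two squared constants serves both branches. *)
exists ((2 * M0) ^+ 2 + Ls ^+ 2).
  by rewrite ltr_pwDl ?sqr_ge0// exprn_gt0// mulr_gt0.
move=> x y; rewrite minr_pMr ?addr_ge0 ?sqr_ge0// mulr1 le_min; apply/andP;
  split.
  apply: (@le_trans _ _ ((2 * M0) ^+ 2)); last by rewrite lerDl sqr_ge0.
  have M0_ge0 := ltW M00.
  rewrite -real_normK ?num_real// lerXn2r ?nnegrE ?mulr_ge0//.
  by rewrite (le_trans (ler_normB _ _))// mulr_natl mulr2n lerD.
apply: (@le_trans _ _ (Ls ^+ 2 * enorm (x - y) ^+ 2)); last first.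
  by rewrite ler_wpM2r ?sqr_ge0// lerDr sqr_ge0.
rewrite -exprMn -real_normK ?num_real// lerXn2r ?nnegrE//.
by rewrite mulr_ge0// enorm_ge0.
Qed.

End test_functions.

(** * Volumes of balls and radial integrals *)

Section lebesgue_balls.
Context {R : realType}.
Local Open Scope ereal_scope.

Lemma ge0_integral_set d (T : measurableType d) (mu : {measure set T -> \bar R})
    (D : set T) (f : T -> R) :
  \int[mu]_(x in D) (f x)%:E = \int[mu]_x (f x * \1_D x)%:E.
Proof.
rewrite integral_mkcond epatch_indic; apply: eq_integral => x _ /=.
by rewrite EFinM.
Qed.

Lemma measurable_eball n (r : R) : measurable (@eball R n r).
Proof.
rewrite /eball -[X in measurable X]setTI.
exact: (measurable_fun_ltr (@measurable_enorm R n) (measurable_cst r)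
  measurableT).
Qed.

Let box n (r : R) := [set x : 'rV[R]_n | forall i, (`|x ord0 i| <= r)%R].

Let measurable_box n (r : R) : measurable (@box n r).
Proof.
have -> : @box n r = \bigcap_(i in [set: 'I_n])
    ((fun y : 'rV[R]_n => y ord0 i) @^-1` `[(- r)%R, r]%classic).
  apply/seteqP; split => x /= xr i.
    by move=> _; have := xr i; rewrite /= in_itv/= ler_norml.
  by have := xr i I; rewrite /= in_itv/= ler_norml.
apply: fin_bigcap_measurable => // i _.
rewrite -[X in measurable X]setTI; exact: measurable_coord.
Qed.

(** Cubes factor under the product measure, which balls do not; a ball is then enclosed in a
    cube. *)
Let lebesgue_rV_box_lty n (r : R) : lebesgue_rV n (@box n r) < +oo.
Proof.
elim: n => [|n IH].
  by rewrite /= diracE ltry.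
rewrite [ltLHS](_ : _ = (@lebesgue_measure R \x lebesgue_rV n)
  (`[(- r)%R, r]%classic `*` @box n r)).
  rewrite product_measure1E//; last exact: measurable_box.
  rewrite /= lebesgue_measure_itv/=; case: ifPn => _;
    last by rewrite mul0e ltry.
  by rewrite -EFinB -[lebesgue_rV n _]fineK ?ge0_fin_numE// -EFinM ltry.
rewrite /= /lebesgue_cons /pushforward; congr (_ \x _).
apply/seteqP; split => [[t y] /= ty|[t y] /= [tr yr] i].
- split.
    have := ty (lshift n (ord0 : 'I_1)); rewrite /rV_cons (@row_mxEl _ 1 1 n)
      mxE/= mulr1n.
    by rewrite in_itv/= ler_norml.
  by move=> i; have := ty (rshift 1 i); rewrite /rV_cons (@row_mxEr _ 1 1 n).
- rewrite /rV_cons; case: (@split_ordP 1 n i) => k ->.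
    by rewrite (@row_mxEl _ 1 1 n) mxE [k]ord1/= mulr1n ler_norml; move: tr;
      rewrite in_itv.
  by rewrite (@row_mxEr _ 1 1 n).
Qed.

Lemma lebesgue_rV_eball_lty n (r : R) : lebesgue_rV n (eball r) < +oo.
Proof.
apply: le_lt_trans (lebesgue_rV_box_lty n r); apply: le_measure.
- by rewrite inE; exact: measurable_eball.
- by rewrite inE; exact: measurable_box.
- move=> x /= xr i; apply: (le_trans (normr_coord_le x i)); exact: ltW.
Qed.

Lemma lebesgue_rV_setT_neq0 n : lebesgue_rV n [set: 'rV[R]_n] != 0.
Proof.
elim: n => [|n IH]; first by rewrite /= diracT onee_neq0.
rewrite [X in X != _](_ : _ = (@lebesgue_measure R \x lebesgue_rV n) ([set: R]
  `*` setT)).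
  rewrite product_measure1E// mule_neq0// -set_itvNyy.
  by have /= -> := @lebesgue_measure_itv R `]-oo, +oo[.
by rewrite setXTT.
Qed.

Lemma lebesgue_rV_affine n (A : set 'rV[R]_n) (c : R) (b : 'rV[R]_n) :
  (0 < c)%R -> measurable A ->
  lebesgue_rV n [set x | A (c *: x + b)%R] = (c ^- n)%:E * lebesgue_rV n A.
Proof.
move=> c0 mA.
have mA' : measurable [set x | A (c *: x + b)%R].
  rewrite -[X in measurable X]setTI; exact: (measurable_affine c b).
transitivity (\int[lebesgue_rV n]_x (\1_[set x | A (c *: x + b)%R] x)%:E).
  by rewrite integral_indic// setIT.
rewrite (@ge0_integral_rV_affine R n (fun x => (\1_A x)%:E) c b c0).
- by rewrite integral_indic// setIT.
- exact/measurable_EFinP/measurable_indic.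
- by move=> x; rewrite lee_fin.
Qed.

(** If one ball were null, so would be all its dilations, and countably many of them cover the
    space. *)
Lemma lebesgue_rV_eball_gt0 n (r : R) : (0 < r)%R -> 0 < lebesgue_rV n (@eball
  R n r).
Proof.
move=> r0; rewrite lt0e measure_ge0 andbT; apply: contra_neq
  (lebesgue_rV_setT_neq0 n) => B0.
have -> : [set: 'rV[R]_n] = \bigcup_(k : nat) @eball R n (k.+1%:R * r)%R.
  apply/seteqP; split=> // x _.
  exists (Num.truncn (enorm x / r)%R) => //=.
  by rewrite /eball/= -ltr_pdivrMr// truncnS_gt.
apply/eqP; rewrite eq_le measure_ge0 andbT.
apply: (le_trans (measure_sigma_subadditive _ _ _ (@subset_refl _ _))).
- by move=> k; exact: measurable_eball.
- by apply: bigcup_measurable => k _; exact: measurable_eball.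
rewrite eseries0// => k _ _.
have k0 : (0 < (k.+1%:R : R)^-1)%R by rewrite invr_gt0 ltr0n.
have := lebesgue_rV_affine 0 k0 (@measurable_eball n r).
rewrite B0 mule0 => <-; congr (lebesgue_rV n _).
apply/seteqP; split => x; rewrite /eball/= addr0 enormZ gtr0_norm// ltr_pdivrMl
  ?ltr0n//.
Qed.

End lebesgue_balls.

Section radial_integrals.
Context {R : realType} {n : nat}.
Local Open Scope ereal_scope.

Lemma nneseries_geometric_lty (q : R) (I : \bar R) : (0 <= q < 1)%R ->
  0 <= I -> I < +oo -> \sum_(0 <= k <oo) ((q ^+ k)%:E * I) < +oo.
Proof.
move=> /andP[q0 q1] I0 Ioo.
have [r r0 ->] : exists2 r : R, (0 <= r)%R & I = r%:E.
  exists (fine I); first exact: fine_ge0.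
  by rewrite fineK// ge0_fin_numE.
have u0 k : 0 <= (q ^+ k)%:E * r%:E by rewrite -EFinM lee_fin mulr_ge0//
  exprn_ge0.
have q10 : (0 < 1 - q)%R by rewrite subr_gt0.
apply: (@le_lt_trans _ _ (r / (1 - q))%:E); last exact: ltry.
apply: lime_le; first exact: is_cvg_nneseries.
apply: nearW => m; under eq_bigr do rewrite -EFinM.
rewrite sumEFin lee_fin -mulr_suml mulrC ler_wpM2l//.
rewrite -[leRHS]mul1r ler_pdivlMr// mulrC.
have -> : ((1 - q) * \sum_(0 <= k < m) q ^+ k = 1 - q ^+ m)%R.
  by rewrite big_mkord -opprB mulNr -subrX1 opprB.
by rewrite gerBl exprn_ge0.
Qed.

(* Homogeneity turns the integrals over the dilated shells into a geometric
   series of ratio [c^(-(p+n))]. *)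
Lemma integral_shells_lty (p c B : R) (S D : set 'rV[R]_n) :
  (0 < c)%R -> (c `^ (- p) * c ^- n < 1)%R -> measurable S -> measurable D ->
  lebesgue_rV n S < +oo -> (0 <= B)%R ->
  (forall x, S x -> (enorm x `^ p <= B)%R) ->
  (forall x, D x -> exists k : nat, S (c ^+ k *: x)%R) ->
  \int[lebesgue_rV n]_(x in D) (enorm x `^ p)%:E < +oo.
Proof.
move=> c0 q1 mS mD Soo B0 SB DS.
pose q := (c `^ (- p) * c ^- n)%R.
have q0 : (0 <= q)%R by rewrite mulr_ge0 ?powR_ge0// invr_ge0 exprn_ge0// ltW.
pose H (x : 'rV[R]_n) := (enorm x `^ p * \1_S x)%R.
have mp : measurable_fun setT (fun x : 'rV[R]_n => enorm x `^ p)%R.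
  exact: (measurableT_comp (measurable_powR p) (@measurable_enorm R n)).
have mH : measurable_fun setT H by apply: measurable_funM.
have H0 x : (0 <= H x)%R by rewrite mulr_ge0// powR_ge0.
pose I := \int[lebesgue_rV n]_x (H x)%:E.
have I0 : 0 <= I by apply: integral_ge0 => x _; rewrite lee_fin.
have Ioo : I < +oo.
  apply: (@le_lt_trans _ _ (\int[lebesgue_rV n]_x (B * \1_S x)%:E)).
    apply: ge0_le_integral => //.
    - by move=> x _; rewrite lee_fin.
    - exact/measurable_EFinP.
    - by apply/measurable_EFinP; apply: measurable_funM.
    - move=> x _; rewrite lee_fin /H indicE; have [xS|] := boolP (x \in S).
        by rewrite !mulr1 SB//; exact/set_mem.
      by rewrite !mulr0.
  rewrite -ge0_integral_set integral_cst//.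
  by apply: lte_mul_pinfty => //; rewrite lee_fin.
(* By homogeneity [f k] is |x|^p times the indicator of the k-th shell, the set of x with c^k x in
   [S]. *)
pose f k (x : 'rV[R]_n) := ((c ^+ k) `^ (- p))%:E * (H (c ^+ k *: x)%R)%:E.
have f0 k x : 0 <= f k x by apply: mule_ge0; rewrite lee_fin ?powR_ge0.
have mf k : measurable_fun setT (f k).
  apply: measurable_funeM => //; apply/measurable_EFinP.
  have := measurableT_comp mH (@measurable_affine R n (c ^+ k) 0).
  by apply: eq_measurable_fun => x _ /=; rewrite addr0.
have fI k : \int[lebesgue_rV n]_x f k x = (q ^+ k)%:E * I.
  have ck0 : (0 < c ^+ k)%R by rewrite exprn_gt0.
  rewrite ge0_integralZl_EFin//.
  - transitivity (((c ^+ k) `^ (- p))%:E *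
        \int[lebesgue_rV n]_x (H (c ^+ k *: x + 0)%R)%:E).
      by congr (_ * _); apply: eq_integral => x _; rewrite addr0.
    rewrite (@ge0_integral_rV_affine R n (fun x => (H x)%:E) _ 0 ck0)//.
    + rewrite muleA -EFinM; congr (_%:E * _).
      rewrite /q exprMn exprVn -!exprM mulnC; congr (_ * _)%R.
      rewrite -(powR_mulrn k (ltW c0)) -powRrM mulrC powRrM.
      by rewrite powR_mulrn// powR_ge0.
    + exact/measurable_EFinP.
  - move=> x _; by rewrite lee_fin.
  - apply/measurable_EFinP.
    have := measurableT_comp mH (@measurable_affine R n (c ^+ k) 0).
    by apply: eq_measurable_fun => x _ /=; rewrite addr0.
  - exact: powR_ge0.
rewrite ge0_integral_set.
(* Every point of [D] lies in some shell, so the series dominates the integrand; overlapping shells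
   only enlarge it. *)
apply: (@le_lt_trans _ _ (\int[lebesgue_rV n]_x \sum_(0 <= k <oo) f k x)).
  apply: ge0_le_integral => //.
  - by move=> x _; rewrite lee_fin mulr_ge0// powR_ge0.
  - by apply/measurable_EFinP; apply: measurable_funM.
  - apply: ge0_emeasurable_sum => //.
  - move=> x _; rewrite indicE; have [xD|_] := boolP (x \in D); last first.
      by rewrite mulr0; apply: nneseries_ge0.
    rewrite mulr1; have [k Sk] := DS _ (set_mem xD).
    apply: (@le_trans _ _ (f k x)); last first.
      apply: (le_trans _ (@nneseries_lim_ge R (fun k => f k x) xpredT 0 k.+1
        _)) => //.
      by rewrite big_nat_recr//= leeDr// sume_ge0.
    have ck0 : (0 < c ^+ k)%R by rewrite exprn_gt0.
    rewrite /f /H indicE mem_set// mulr1 -EFinM lee_fin enormZ (gtr0_norm ck0).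
    rewrite (powRM _ (ltW ck0) (enorm_ge0 x)) mulrA powRN mulVf ?mul1r//.
    by rewrite gt_eqF// powR_gt0.
rewrite integral_nneseries//.
under eq_eseriesr do rewrite fI.
by apply: nneseries_geometric_lty => //; rewrite q0.
Qed.

End radial_integrals.

(** * Integrability of the truncated kernel *)

Section kernel.
Context {R : realType} {N : nat} (s : R).
Hypotheses (hN : (1 <= N)%N) (s0 : 0 < s) (s1 : s < 1).
Implicit Types (f g u v zeta : 'rV[R]_N -> R) (A B : set 'rV[R]_N).

(** Adding the two end values covers both monotonicities, so the sign of the exponent need not be
    known. *)
Lemma powR_le_ends (a b e p : R) : 0 < a -> a <= e -> e <= b ->
  e `^ p <= a `^ p + b `^ p.
Proof.
move=> a0 ae eb; have e0 : 0 < e by exact: lt_le_trans ae.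
have b0 : 0 < b by exact: lt_le_trans eb.
have [p0|p0] := leP 0 p.
  rewrite (@le_trans _ _ (b `^ p))// ?lerDr ?powR_ge0//.
  by apply: ge0_ler_powR => //; rewrite nnegrE ltW.
rewrite (@le_trans _ _ (a `^ p))// ?lerDl ?powR_ge0//.
rewrite -[p]opprK !(powRN _ (- p)) lef_pV2 ?posrE ?powR_gt0//.
by apply: ge0_ler_powR => //; rewrite ?nnegrE ?oppr_ge0; exact: ltW.
Qed.

Let a : R := N%:R + 2 * s.

Lemma powR_lt1_exp (c r : R) : 0 < c -> ln c * r < 0 -> c `^ r < 1.
Proof. by move=> c0 cr; rewrite /powR gt_eqF// -expR0 ltr_expR mulrC. Qed.

(** Near the origin the integrand is |z|^(2-N-2s), and doubling towards the unit shell gives the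
    ratio 2^(-(2-2s)); far away it is |z|^(-N-2s), and halving gives the ratio 2^(-2s). Both are
    below 1 since 0 < s < 1. *)
Lemma kernel_integral_lty :
  (\int[lebesgue_rV N]_z
    (Num.min 1 (enorm z ^+ 2) * enorm z `^ (- a))%:E < +oo)%E.
Proof.
have ls0 := s0; have ls1 := s1.
have ln2_gt0 : 0 < ln 2 :> R by rewrite ln_gt0// ltr1n.
have mE := @measurable_enorm R N.
have mshell (x y : R) : measurable [set z : 'rV[R]_N | x <= enorm z < y].
  rewrite (_ : [set z | _] = @enorm R N @^-1` `[x, y[%classic).
    by rewrite -[X in measurable X]setTI; exact: mE.
  by apply/seteqP; split => z /=; rewrite in_itv.
have shell_lty (x y : R) : (lebesgue_rV N [set z : 'rV[R]_N | (x <= enorm z <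
  y)%R] < +oo)%E.
  apply: le_lt_trans (lebesgue_rV_eball_lty N y); apply: le_measure.
  - by rewrite inE.
  - by rewrite inE; exact: measurable_eball.
  - by move=> z /= /andP[].
have mout : measurable [set z : 'rV[R]_N | 1 <= enorm z].
  rewrite (_ : [set z | _] = @enorm R N @^-1` `[1, +oo[%classic).
    by rewrite -[X in measurable X]setTI; exact: mE.
  by apply/seteqP; split => z /=; rewrite in_itv/= andbT.
have powN (c : R) : 0 < c -> c ^- N = c `^ (- N%:R).
  by move=> c0; rewrite powRN powR_mulrn// ltW.
have I1 : (\int[lebesgue_rV N]_(x in @punctured_ball R N) (enorm x `^ (2 -
  a)%R)%:E < +oo)%E.
  apply: (@integral_shells_lty R N (2 - a) 2 (2^-1 `^ (2 - a) + 1 `^ (2 - a))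
    [set z | 2^-1 <= enorm z < 1]) => //.
  - rewrite powN// -powRD; last by rewrite pnatr_eq0 implybT.
    apply: powR_lt1_exp => //; rewrite pmulr_rlt0// /a; lra.
  - exact: measurable_punctured_ball.
  - move=> x /= /andP[x2 /ltW x1]; apply: powR_le_ends => //; lra.
  - move=> x /= /andP[e0 e1].
    have exk : exists k, 2^-1 <= 2 ^+ k * enorm x.
      exists (Num.truncn (enorm x)^-1); rewrite -ler_pdivrMr//.
      have /ltW := truncnS_gt (enorm x)^-1.
      have : ((Num.truncn (enorm x)^-1).+1 <= 2 ^ (Num.truncn (enorm x)^-1))%N
        by rewrite ltn_expl.
      rewrite -(ler_nat R) natrX => h1 h2.
      have h3 : 2^-1 * (enorm x)^-1 <= (enorm x)^-1.
        by rewrite ler_piMl ?invr_ge0 ?enorm_ge0// invf_le1// ler1n.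
      exact: (le_trans h3 (le_trans h2 h1)).
    (* The least such [k] lands in the shell: one doubling fewer stays below 1/2, so 2^k |x| < 1. *)
    exists (ex_minn exk); case: ex_minnP => k kP kmin.
    rewrite enormZ ger0_norm ?exprn_ge0// kP/=.
    case: k kP kmin => [|k] kP kmin; first by rewrite expr0 mul1r.
    rewrite exprS -mulrA -ltr_pdivlMl// mulr1 ltNge; apply/negP => /kmin.
    by rewrite ltnn.
have I2 : (\int[lebesgue_rV N]_(x in [set z | (1 <= enorm z)%R]) (enorm x `^ (-
  a)%R)%:E < +oo)%E.
  apply: (@integral_shells_lty R N (- a) 2^-1 (1 `^ (- a) + 2 `^ (- a))
    [set z | 1 <= enorm z < 2]) => //.
  - rewrite powN// -powRD; last by rewrite invr_eq0 pnatr_eq0 implybT.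
    apply: powR_lt1_exp => //; rewrite lnV ?posrE// mulNr oppr_lt0 mulr_gt0//
      /a; lra.
  - by move=> x /= /andP[x2 /ltW x1]; exact: powR_le_ends.
  - move=> x /= e1.
    have exk : exists k, 2^-1 ^+ k * enorm x < 2.
      exists (Num.truncn (enorm x)); rewrite exprVn -ltr_pdivlMl ?invr_gt0
        ?exprn_gt0// invrK.
      have := truncnS_gt (enorm x).
      have : ((Num.truncn (enorm x)).+1 <= 2 ^ (Num.truncn (enorm x)))%N by
        rewrite ltn_expl.
      rewrite -(ler_nat R) natrX => h1 h2.
      have h3 : 2 ^+ Num.truncn (enorm x) <= 2 ^+ Num.truncn (enorm x) * 2 :> R.
        by rewrite ler_peMr ?exprn_ge0// ler1n.
      exact: (lt_le_trans h2 (le_trans h1 h3)).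
    exists (ex_minn exk); case: ex_minnP => k kP kmin.
    rewrite enormZ ger0_norm ?exprn_ge0 ?invr_ge0// kP andbT.
    case: k kP kmin => [|k] kP kmin; first by rewrite expr0 mul1r.
    rewrite exprS -mulrA -ler_pdivrMl ?invr_gt0// invrK mulr1 leNgt;
      apply/negP => /kmin.
    by rewrite ltnn.
have mpow p : measurable_fun setT (fun x : 'rV[R]_N => enorm x `^ p).
  exact: (measurableT_comp (measurable_powR p) mE).
have mmin : measurable_fun setT
    (fun z : 'rV[R]_N => Num.min 1 (enorm z ^+ 2) * enorm z `^ (- a)).
  apply: measurable_funM => //; apply: measurable_minr => //.
  by apply: measurable_funX.
rewrite ge0_integral_set in I1; rewrite ge0_integral_set in I2.
apply: le_lt_trans (lte_add_pinfty I1 I2).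
rewrite -ge0_integralD//.
- apply: ge0_le_integral => //.
  + move=> x _; rewrite lee_fin mulr_ge0 ?powR_ge0//.
    by rewrite le_min ler01 sqr_ge0.
  + exact/measurable_EFinP.
  + apply: emeasurable_funD; apply/measurable_EFinP;
    apply: measurable_funM => //.
    apply: measurable_indic; exact: measurable_punctured_ball.
  + move=> x _; rewrite -EFinD lee_fin !indicE.
    have [e0|e0] := eqVneq (enorm x) 0.
      rewrite e0 expr0n/= (min_r (@ler01 R)) mul0r addr_ge0// mulr_ge0//
        powR_ge0//.
    have {}e0 : 0 < enorm x by rewrite lt0r e0 enorm_ge0.
    have [e1|e1] := leP 1 (enorm x).
      rewrite (mem_set (_ : [set z | 1 <= enorm z] x))// mulr1.
      rewrite -[leLHS]add0r lerD ?mulr_ge0 ?powR_ge0//.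
      by rewrite ler_piMl ?powR_ge0// ge_min lexx.
    rewrite (mem_set (_ : punctured_ball x))/= ?mulr1; last by apply/andP.
    rewrite -[leLHS]addr0 lerD ?mulr_ge0 ?powR_ge0//.
    have -> : enorm x `^ (2 - a) = enorm x ^+ 2 * enorm x `^ (- a).
      rewrite powRD; last by rewrite (gt_eqF e0) implybT.
      by rewrite (powR_mulrn 2 (enorm_ge0 x)).
    by rewrite ler_wpM2r ?powR_ge0// ge_min lexx orbT.
- by move=> x _; rewrite lee_fin mulr_ge0// powR_ge0.
- apply/measurable_EFinP; apply: measurable_funM => //.
  apply: measurable_indic; exact: measurable_punctured_ball.
- by move=> x _; rewrite lee_fin mulr_ge0// powR_ge0.
- by apply/measurable_EFinP; apply: measurable_funM.
Qed.

End kernel.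

(** * The Gagliardo seminorm *)

Section gagliardo.
Context {R : realType} {N : nat} (s : R).
Implicit Types (f g u v zeta : 'rV[R]_N -> R) (A B : set 'rV[R]_N).
Local Notation leb := (lebesgue_rV N).
Local Notation leb2 := (leb \x leb)%E.
Local Notation kern := (@gagliardo_kernel R N s).

Lemma gagliardo_kernel_ge0 p : 0 <= kern p.
Proof. exact: powR_ge0. Qed.

Lemma measurable_subv : measurable_fun setT
  (fun p : 'rV[R]_N * 'rV[R]_N => p.1 - p.2 : 'rV[R]_N).
Proof.
apply/measurable_fun_rVP => i; under eq_fun do rewrite !mxE.
apply: measurable_funB.
  exact: (measurableT_comp (@measurable_coord R N i) measurable_fst).
exact: (measurableT_comp (@measurable_coord R N i) measurable_snd).
Qed.

Lemma measurable_edist : measurable_fun setT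
  (fun p : 'rV[R]_N * 'rV[R]_N => enorm (p.1 - p.2)).
Proof. exact: (measurableT_comp (@measurable_enorm R N) measurable_subv). Qed.

Lemma measurable_gagliardo_kernel : measurable_fun setT kern.
Proof. exact: (measurableT_comp (measurable_powR _) measurable_edist). Qed.

Definition gagliardo_integrand u (p : 'rV[R]_N * 'rV[R]_N) : R :=
  (u p.1 - u p.2) ^+ 2 * kern p.

Lemma gagliardo_integrand_ge0 u p : 0 <= gagliardo_integrand u p.
Proof. by rewrite mulr_ge0 ?sqr_ge0// gagliardo_kernel_ge0. Qed.

Lemma measurable_gagliardo_integrand u : measurable_fun setT u ->
  measurable_fun setT (gagliardo_integrand u).
Proof.
move=> mu; apply: measurable_funM; last exact: measurable_gagliardo_kernel.
apply: measurable_funX; apply: measurable_funB.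
  exact: (measurableT_comp mu measurable_fst).
exact: (measurableT_comp mu measurable_snd).
Qed.

Lemma gagliardo2E u :
  gagliardo2 s setT u = (\int[leb2]_p (gagliardo_integrand u p)%:E)%E.
Proof. by rewrite /gagliardo2 setXTT. Qed.

Lemma gagliardo2_ge0 A u : (0 <= gagliardo2 s A u)%E.
Proof.
by apply: integral_ge0 => p _; rewrite lee_fin; exact: gagliardo_integrand_ge0.
Qed.

(** Young's inequality 2ab <= t a^2 + b^2/t under the integral. It holds in the extended reals
    without integrability conditions, and the free weight [t] lets a small [v] perturb [u] at
    arbitrarily small cost. *)
Lemma gagliardo2D u v (t : R) : 0 < t ->
  measurable_fun setT u -> measurable_fun setT v ->
  (gagliardo2 s setT (fun x => u x + v x)%R <=
   (1 + t)%:E * gagliardo2 s setT u + (1 + t^-1)%:E * gagliardo2 s setT v)%E.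
Proof.
move=> t0 mu mv; rewrite !gagliardo2E.
have mgu := measurable_gagliardo_integrand mu.
have mgv := measurable_gagliardo_integrand mv.
have tV0 : 0 < t^-1 by rewrite invr_gt0.
rewrite -!ge0_integralZl_EFin//; first last.
- by rewrite addr_ge0// ltW.
- exact/measurable_EFinP.
- by move=> p _; rewrite lee_fin gagliardo_integrand_ge0.
- by rewrite addr_ge0// ltW.
- exact/measurable_EFinP.
- by move=> p _; rewrite lee_fin gagliardo_integrand_ge0.
have nng c f p : 0 < c -> (0 <= (1 + c)%:E * (gagliardo_integrand f p)%:E)%E.
  move=> c0; rewrite -EFinM lee_fin mulr_ge0 ?gagliardo_integrand_ge0//.
  by rewrite addr_ge0// ltW.
rewrite -ge0_integralD//; first last.
- by apply: measurable_funeM; exact/measurable_EFinP.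
- by move=> p _; exact: nng.
- by apply: measurable_funeM; exact/measurable_EFinP.
- by move=> p _; exact: nng.
apply: ge0_le_integral => //.
- by move=> p _; rewrite lee_fin gagliardo_integrand_ge0.
- apply/measurable_EFinP; apply: measurable_gagliardo_integrand;
  by apply: measurable_funD.
- by apply: emeasurable_funD; apply: measurable_funeM; exact/measurable_EFinP.
move=> p _; rewrite -!EFinM -EFinD lee_fin /gagliardo_integrand !mulrA -mulrDl.
rewrite ler_wpM2r ?gagliardo_kernel_ge0//.
set a := u p.1 - u p.2; set b := v p.1 - v p.2.
have -> : u p.1 + v p.1 - (u p.2 + v p.2) = a + b by rewrite /a /b; ring.
(* Expanding this square is Young's inequality. *)
have h : 0 <= t^-1 * (t * a - b) ^+ 2 by rewrite mulr_ge0 ?sqr_ge0 ?(ltW tV0).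
have hE : t^-1 * (t * a - b) ^+ 2 = t * a ^+ 2 + t^-1 * b ^+ 2 - 2 * a * b.
  by field; rewrite gt_eqF.
rewrite hE in h.
have -> : (a + b) ^+ 2 = a ^+ 2 + b ^+ 2 + 2 * a * b by ring.
rewrite !mulrDl !mul1r; lra.
Qed.

Lemma gagliardo2Z (c : R) u : measurable_fun setT u ->
  (gagliardo2 s setT (fun x => c * u x)%R = (c ^+ 2)%:E * gagliardo2 s setT
    u)%E.
Proof.
move=> mu; rewrite !gagliardo2E -ge0_integralZl_EFin ?sqr_ge0//.
- apply: eq_integral => p _; rewrite -EFinM /gagliardo_integrand; congr EFin.
  by rewrite /= -mulrBr exprMn -mulrA.
- by move=> p _; rewrite lee_fin gagliardo_integrand_ge0.
- by apply/measurable_EFinP; exact: measurable_gagliardo_integrand.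
Qed.

Lemma gagliardo2N u :
  gagliardo2 s setT (fun x => - u x) = gagliardo2 s setT u.
Proof.
rewrite !gagliardo2E; apply: eq_integral => p _; congr EFin.
by rewrite /gagliardo_integrand -opprD sqrrN.
Qed.

(** The Gagliardo kernel times the Lipschitz bound of a test function: integrable, unlike the
    kernel. *)
Let trunc_kernel (z : 'rV[R]_N) : R :=
  Num.min 1 (enorm z ^+ 2) * enorm z `^ (- (N%:R + 2 * s)).

Let trunc_kernel_ge0 z : 0 <= trunc_kernel z.
Proof. by rewrite mulr_ge0 ?powR_ge0// le_min ler01 sqr_ge0. Qed.

Let measurable_trunc_kernel : measurable_fun setT trunc_kernel.
Proof.
apply: measurable_funM.
  apply: measurable_minr => //; apply: measurable_funX; exact: measurable_enorm.
exact: (measurableT_comp (measurable_powR _) (@measurable_enorm R N)).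
Qed.

Let trunc_kernelN z : trunc_kernel (- z) = trunc_kernel z.
Proof. by rewrite /trunc_kernel enormN. Qed.

Let trunc_kernel_translate y :
  (\int[leb]_x (trunc_kernel (x - y))%:E = \int[leb]_x (trunc_kernel x)%:E)%E.
Proof.
transitivity (\int[leb]_x (trunc_kernel (1 *: x + - y))%:E)%E.
  by apply: eq_integral => x _; rewrite scale1r.
rewrite (@ge0_integral_rV_affine R N (fun x => (trunc_kernel x)%:E) 1 (- y))//.
- by rewrite expr1n invr1 mul1e.
- exact/measurable_EFinP.
Qed.

(** Tonelli and translation invariance: integrating out the variable that the weight does not see
    leaves the total mass of the kernel. Placing the weight on the first variable also uses that the
    kernel is even. *)
Let trunc_kernel_weight (h : 'rV[R]_N -> R) : measurable_fun setT h -> (forall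
  x, 0 <= h x) ->
  (\int[leb2]_p (trunc_kernel (p.1 - p.2)%R * h p.2)%:E =
    \int[leb]_x (trunc_kernel x)%:E * \int[leb]_x (h x)%:E)%E /\
  (\int[leb2]_p (trunc_kernel (p.1 - p.2)%R * h p.1)%:E =
    \int[leb]_x (trunc_kernel x)%:E * \int[leb]_x (h x)%:E)%E.
Proof.
move=> mh h0.
have mk : measurable_fun setT
    (fun p : 'rV[R]_N * 'rV[R]_N => trunc_kernel (p.1 - p.2)).
  exact: (measurableT_comp measurable_trunc_kernel measurable_subv).
have mk1 y : measurable_fun setT (fun x : 'rV[R]_N => (trunc_kernel (x -
  y))%:E).
  by apply/measurable_EFinP; exact: (measurable_fun_pair1 y mk).
split.
- rewrite (fubini_tonelli2 (fun p : 'rV[R]_N * 'rV[R]_N =>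
    (trunc_kernel (p.1 - p.2)%R * h p.2)%:E)).
  + rewrite -ge0_integralZl//.
    * apply: eq_integral => y _; rewrite /fubini_G /=.
      rewrite -(trunc_kernel_translate y) -(@ge0_integralZr _ _ _ leb _
        measurableT
        (fun x => (trunc_kernel (x - y))%:E) (mk1 y))//.
        by move=> x _; rewrite lee_fin.
      by rewrite lee_fin.
    * exact/measurable_EFinP.
    * by move=> x _; rewrite lee_fin.
    * by apply: integral_ge0 => x _; rewrite lee_fin.
  + apply/measurable_EFinP; apply: measurable_funM => //.
    exact: (measurableT_comp mh measurable_snd).
  + by move=> p; rewrite lee_fin mulr_ge0.
- rewrite (fubini_tonelli1 (fun p : 'rV[R]_N * 'rV[R]_N =>
    (trunc_kernel (p.1 - p.2)%R * h p.1)%:E)).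
  + rewrite -ge0_integralZl//.
    * apply: eq_integral => x _; rewrite /fubini_F /=.
      under eq_integral => y _ do rewrite -opprB trunc_kernelN.
      rewrite -(trunc_kernel_translate x) -(@ge0_integralZr _ _ _ leb _
        measurableT
        (fun y => (trunc_kernel (y - x))%:E) (mk1 x))//.
        by move=> y _; rewrite lee_fin.
      by rewrite lee_fin.
    * exact/measurable_EFinP.
    * by move=> x _; rewrite lee_fin.
    * by apply: integral_ge0 => x _; rewrite lee_fin.
  + apply/measurable_EFinP; apply: measurable_funM => //.
    exact: (measurableT_comp mh measurable_fst).
  + by move=> p; rewrite lee_fin mulr_ge0.
Qed.

Hypotheses (s0 : 0 < s) (s1 : s < 1).

(** Discrete Leibniz rule: the increment of the product is zeta(x) (g(x) - g(y)) + (zeta(x) -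
    zeta(y)) g(y). The first term costs the seminorm on [B], the second the L^2 norm through the
    truncated kernel. No control of [g] outside [B] is required, because with one point outside only
    the increment of [zeta] remains. *)
Lemma gagliardo2_mul_le A B zeta : test_function A zeta ->
  (forall x, zeta x != 0 -> B x) -> measurable B ->
  exists2 C : R, 0 <= C & forall g, measurable_fun setT g ->
    (gagliardo2 s setT (fun x => (zeta x * g x)%R) <= C%:E * hs_norm2 s B g)%E.
Proof.
move=> tz zB mB; have [sz _ _] := tz.
have [M0 /ltW M00 zM0] := test_function_bounded tz.
have [M /ltW M_ge0 zM] := test_function_lipschitz tz.
have mz := smooth_measurable sz.
pose I := (\int[leb]_x (trunc_kernel x)%:E)%E.
have I0 : (0 <= I)%E by apply: integral_ge0 => x _; rewrite lee_fin.
have [r r0 IE] : exists2 r : R, 0 <= r & I = r%:E.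
  exists (fine I); first exact: fine_ge0.
  by rewrite fineK// ge0_fin_numE// kernel_integral_lty.
(* The seminorm gets 2 M0^2 ([F1]); each of the weights at y and at x contributes 2 M r to the L^2
   part ([F2], [F3]). *)
exists (2 * M0 ^+ 2 + 4 * M * r).
  by rewrite addr_ge0// mulr_ge0// ?mulr_ge0// sqr_ge0.
move=> g mg.
pose h x := g x ^+ 2 * \1_B x.
have mh : measurable_fun setT h.
  by apply: measurable_funM; [exact: measurable_funX|exact: measurable_indic].
have h0 x : 0 <= h x by rewrite mulr_ge0 ?sqr_ge0.
have [W2 W1] := trunc_kernel_weight mh h0.
have mk : measurable_fun setT
    (fun p : 'rV[R]_N * 'rV[R]_N => trunc_kernel (p.1 - p.2)).
  exact: (measurableT_comp measurable_trunc_kernel measurable_subv).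
have mB2 : measurable (B `*` B) by exact: measurableX.
pose F1 p := 2 * M0 ^+ 2 * (gagliardo_integrand g p * \1_(B `*` B) p).
pose F2 (p : 'rV[R]_N * 'rV[R]_N) := 2 * M * (trunc_kernel (p.1 - p.2) * h p.2).
pose F3 (p : 'rV[R]_N * 'rV[R]_N) := 2 * M * (trunc_kernel (p.1 - p.2) * h p.1).
have mG1 : measurable_fun setT (fun p => gagliardo_integrand g p * \1_(B `*` B)
  p).
  by apply: measurable_funM; [exact: measurable_gagliardo_integrand|exact:
    measurable_indic].
have mG2 : measurable_fun setT
    (fun p : 'rV[R]_N * 'rV[R]_N => trunc_kernel (p.1 - p.2) * h p.2).
  by apply: measurable_funM => //; exact: (measurableT_comp mh measurable_snd).
have mG3 : measurable_fun setT
    (fun p : 'rV[R]_N * 'rV[R]_N => trunc_kernel (p.1 - p.2) * h p.1).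
  by apply: measurable_funM => //; exact: (measurableT_comp mh measurable_fst).
have F10 p : 0 <= F1 p.
  apply: mulr_ge0; first by rewrite mulr_ge0 ?sqr_ge0.
  by rewrite mulr_ge0 ?gagliardo_integrand_ge0.
have F20 p : 0 <= F2 p by apply: mulr_ge0; exact: mulr_ge0.
have F30 p : 0 <= F3 p by apply: mulr_ge0; exact: mulr_ge0.
have pointwise p : gagliardo_integrand (fun x => zeta x * g x) p <= F1 p + F2 p
  + F3 p.
  case: p => x y; rewrite /F1 /F2 /F3 /gagliardo_integrand /h /trunc_kernel /=.
  have -> : enorm (x - y) `^ (- (N%:R + 2 * s)) = kern (x, y) by [].
  set k := kern (x, y); have k0 : 0 <= k by exact: gagliardo_kernel_ge0.
  set m := Num.min _ _.
  have zLip : (zeta x - zeta y) ^+ 2 <= M * m := zM x y.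
  have Mm0 : 0 <= M * m by rewrite mulr_ge0// le_min ler01 sqr_ge0.
  have zM2 : zeta x ^+ 2 <= M0 ^+ 2.
    by rewrite -real_normK ?num_real// lerXn2r ?nnegrE.
  have zNB z : ~ B z -> zeta z = 0.
    by move=> Bz; apply/eqP; apply: contra_notT Bz => /zB.
  rewrite indicE in_setX !indicE.
  have -> : 2 * M0 ^+ 2 * ((g x - g y) ^+ 2 * k * ((x \in B) && (y \in B))%:R) +
     2 * M * (m * k * (g y ^+ 2 * (y \in B)%:R)) +
     2 * M * (m * k * (g x ^+ 2 * (x \in B)%:R)) =
     (2 * M0 ^+ 2 * ((g x - g y) ^+ 2 * ((x \in B) && (y \in B))%:R) +
     2 * (M * m) * (g y ^+ 2 * (y \in B)%:R) +
     2 * (M * m) * (g x ^+ 2 * (x \in B)%:R)) * k by ring.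
  rewrite ler_wpM2r//.
  have gx2 := sqr_ge0 (g x); have gy2 := sqr_ge0 (g y).
  have [Bx|Bx] := boolP (x \in B); have [By|By] := boolP (y \in B) => /=;
    rewrite ?mulr1 ?mulr0 ?addr0 ?add0r.
  - apply: (@le_trans _ _ (2 * (zeta x ^+ 2 * (g x - g y) ^+ 2) +
        2 * ((zeta x - zeta y) ^+ 2 * g y ^+ 2))).
      rewrite -subr_ge0.
      have -> : 2 * (zeta x ^+ 2 * (g x - g y) ^+ 2) +
        2 * ((zeta x - zeta y) ^+ 2 * g y ^+ 2) - (zeta x * g x - zeta y * g y)
          ^+ 2
        = (zeta x * (g x - g y) - (zeta x - zeta y) * g y) ^+ 2 by ring.
      exact: sqr_ge0.
    have h1 : 2 * (zeta x ^+ 2 * (g x - g y) ^+ 2) <= 2 * M0 ^+ 2 * (g x - g y)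
      ^+ 2.
      by rewrite -mulrA ler_wpM2l// ler_wpM2r ?sqr_ge0.
    have h2 : 2 * ((zeta x - zeta y) ^+ 2 * g y ^+ 2) <= 2 * (M * m) * g y ^+ 2.
      by rewrite -mulrA ler_wpM2l// ler_wpM2r.
    have h3 : 0 <= 2 * (M * m) * g x ^+ 2 by apply: mulr_ge0 => //;
      exact: mulr_ge0.
    by apply: (le_trans (lerD h1 h2)); rewrite lerDl.
  - rewrite (zNB y); last by move=> /mem_set; exact/negP.
    rewrite mul0r subr0 exprMn.
    move: zLip; rewrite (zNB y) ?subr0; last by move=> /mem_set; exact/negP.
    move=> zLip; rewrite ler_wpM2r//; apply: (le_trans zLip); lra.
  - rewrite (zNB x); last by move=> /mem_set; exact/negP.
    rewrite mul0r sub0r sqrrN exprMn.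
    move: zLip; rewrite (zNB x) ?sub0r ?sqrrN; last by move=> /mem_set;
      exact/negP.
    move=> zLip; rewrite ler_wpM2r//; apply: (le_trans zLip); lra.
  - rewrite (zNB x); last by move=> /mem_set; exact/negP.
    rewrite (zNB y); last by move=> /mem_set; exact/negP.
    by rewrite !mul0r subrr expr0n.
rewrite gagliardo2E.
apply: (@le_trans _ _ (\int[leb2]_p ((F1 p)%:E + (F2 p)%:E + (F3 p)%:E)))%E.
  apply: ge0_le_integral => //.
  - by move=> p _; rewrite lee_fin gagliardo_integrand_ge0.
  - apply/measurable_EFinP; apply: measurable_gagliardo_integrand;
    by apply: measurable_funM.
  - by apply: emeasurable_funD; [apply: emeasurable_funD|];
    apply/measurable_EFinP;
      apply: measurable_funM.
  - by move=> p _; rewrite -!EFinD lee_fin.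
have mF1 : measurable_fun setT (EFin \o F1).
  by apply/measurable_EFinP; apply: measurable_funM.
have mF2 : measurable_fun setT (EFin \o F2).
  by apply/measurable_EFinP; apply: measurable_funM.
have mF3 : measurable_fun setT (EFin \o F3).
  by apply/measurable_EFinP; apply: measurable_funM.
rewrite ge0_integralD//; first last.
- by move=> p _; rewrite lee_fin.
- exact: (emeasurable_funD mF1 mF2).
- by move=> p _; rewrite -EFinD lee_fin addr_ge0.
rewrite ge0_integralD//; first last.
- by move=> p _; rewrite lee_fin.
- by move=> p _; rewrite lee_fin.
have -> : (\int[leb2]_p (F1 p)%:E = (2 * M0 ^+ 2)%:E * gagliardo2 s B g)%E.
  rewrite /gagliardo2 [in RHS]ge0_integral_set -ge0_integralZl_EFin//.
  - by move=> p _; rewrite lee_fin mulr_ge0 ?gagliardo_integrand_ge0.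
  - exact/measurable_EFinP.
  - by apply: mulr_ge0 => //; exact: sqr_ge0.
have hE : (\int[leb]_x (h x)%:E = \int[leb]_(x in B) (g x ^+ 2)%:E)%E.
  by rewrite [in RHS]ge0_integral_set.
have -> : (\int[leb2]_p (F2 p)%:E = (2 * M * r)%:E * \int[leb]_(x in B) (g x ^+
  2)%:E)%E.
  under eq_integral do rewrite EFinM.
  rewrite ge0_integralZl_EFin//.
  - by rewrite W2 -/I IE hE muleA -EFinM.
  - by move=> p _; rewrite lee_fin mulr_ge0.
  - exact/measurable_EFinP.
  - by rewrite mulr_ge0.
have -> : (\int[leb2]_p (F3 p)%:E = (2 * M * r)%:E * \int[leb]_(x in B) (g x ^+
  2)%:E)%E.
  under eq_integral do rewrite EFinM.
  rewrite ge0_integralZl_EFin//.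
  - by rewrite W1 -/I IE hE muleA -EFinM.
  - by move=> p _; rewrite lee_fin mulr_ge0.
  - exact/measurable_EFinP.
  - by rewrite mulr_ge0.
have G0 := gagliardo2_ge0 B g.
have L0 : (0 <= \int[leb]_(x in B) (g x ^+ 2)%:E)%E.
  by apply: integral_ge0 => x _; rewrite lee_fin sqr_ge0.
have Mr0 : 0 <= 2 * M * r by rewrite !mulr_ge0.
rewrite /hs_norm2; move: (gagliardo2 s B g) G0 L0 => G.
move: (\int[leb]_(x in B) (g x ^+ 2)%:E)%E => L G0 L0.
rewrite -addeA -ge0_muleDl ?lee_fin// -EFinD addeC ge0_muleDr//.
have -> : 2 * M * r + 2 * M * r = 4 * M * r by ring.
apply: leeD; apply: lee_wpmul2r => //; rewrite lee_fin.
  by rewrite lerDr mulr_ge0// sqr_ge0.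
by rewrite lerDl; apply: mulr_ge0 => //; exact: mulr_ge0.
Qed.

End gagliardo.

(** * A Poincare inequality for functions supported in a ball *)

Section poincare.
Context {R : realType} {N : nat} (s : R).
Hypotheses (hN : (1 <= N)%N) (s0 : 0 < s).
Implicit Types (f g u v : 'rV[R]_N -> R) (A B : set 'rV[R]_N).
Local Notation leb := (lebesgue_rV N).
Local Notation leb2 := (leb \x leb)%E.
Local Notation kern := (@gagliardo_kernel R N s).

(** All coordinates exceed [r] by 1, so the unit ball around this point misses [eball r]. *)
Let far_point (r : R) : 'rV[R]_N := const_mx (r + 1).

Let far_ball (r : R) : set 'rV[R]_N := [set y | eball 1 (y - far_point r)].

Let far_ball_coord r y (i : 'I_N) : far_ball r y -> r < y ord0 i.
Proof.
move=> /(le_lt_trans (normr_coord_le _ i)); rewrite !mxE ltr_norml => /andP[].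
by move=> + _; lra.
Qed.

Let kernel_lower_bound r : 0 < r -> exists2 c : R, 0 < c &
  forall x y, eball r x -> far_ball r y -> c <= kern (x, y).
Proof.
move=> r0; pose i0 : 'I_N := Ordinal hN.
pose D : R := N%:R * (r + (1 + `|far_point r|)).
have N0 : 0 < N%:R :> R by rewrite ltr0n.
have D0 : 0 < D by rewrite mulr_gt0// ltr_wpDr// addr_ge0.
exists (D `^ (- (N%:R + 2 * s))); first exact: powR_gt0.
move=> x y xr yf; rewrite /gagliardo_kernel /=.
(* The power function gives the kernel the value 0 on the diagonal, so the lower bound has to
   exclude x = y. *)
have xy0 : 0 < enorm (x - y).
  apply: lt_le_trans (normr_coord_le _ i0); rewrite !mxE normr_gt0 subr_eq0.
  have := far_ball_coord i0 yf; have := le_lt_trans (normr_coord_le x i0) xr.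
  move=> /(le_lt_trans (ler_norm _)) h1 h2; apply/eqP => xy; move: h1.
  by rewrite xy => /(lt_trans h2); rewrite ltxx.
have xyD : enorm (x - y) <= D.
  apply: (le_trans (enorm_le_norm _)); rewrite ler_wpM2l//.
  apply: (le_trans (ler_normB _ _)); apply: lerD.
    by apply: (le_trans (norm_le_enorm x)); exact: ltW.
  rewrite -[y](subrK (far_point r)); apply: (le_trans (ler_normD _ _)).
  by rewrite lerD2r; apply: (le_trans (norm_le_enorm _)); exact: ltW.
have a0 : 0 <= N%:R + 2 * s by rewrite addr_ge0// mulr_ge0// ltW.
rewrite !powRN lef_pV2 ?posrE ?powR_gt0//.
by apply: ge0_ler_powR => //; rewrite nnegrE ltW.
Qed.

Let measurable_far_ball r : measurable (far_ball r).
Proof.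
have := @measurable_affine R N 1 (- far_point r) measurableT _
  (@measurable_eball R N 1).
rewrite setTI; congr measurable; apply/seteqP; split => y;
  by rewrite /far_ball/= scale1r.
Qed.

Let far_ball_measure r : exists2 V : R, 0 < V & leb (far_ball r) = V%:E.
Proof.
have E : leb (far_ball r) = leb (eball 1).
  have := lebesgue_rV_affine (- far_point r) (@ltr01 R) (@measurable_eball R N
    1).
  rewrite expr1n invr1 mul1e => <-; congr (leb _).
  by apply/seteqP; split => y; rewrite /far_ball/= scale1r.
have := lebesgue_rV_eball_lty N (1 : R); have := lebesgue_rV_eball_gt0 N
  (@ltr01 R).
move=> h1 h2; exists (fine (leb (eball 1))); first by rewrite fine_gt0// h1.
by rewrite E fineK// ge0_fin_numE.
Qed.

(* Points of the far ball, where [g] vanishes, see every point of [eball r]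
   with a kernel bounded from below. *)
Lemma gagliardo2_poincare r : 0 < r -> exists2 C : R, 0 <= C &
  forall g, measurable_fun setT g ->
    {ae leb, forall x, ~ eball r x -> g x = 0} ->
    (\int[leb]_x (g x ^+ 2)%:E <= C%:E * gagliardo2 s setT g)%E.
Proof.
move=> r0; have [c c0 ck] := kernel_lower_bound r0.
have [V V0 VE] := far_ball_measure r.
(* For x in the ball, integrating the Gagliardo integrand over y in the far ball already gives at
   least c V g(x)^2. *)
exists (c * V)^-1; first by rewrite invr_ge0 mulr_ge0// ltW.
move=> g mg g0.
have cV0 : 0 < c * V by rewrite mulr_gt0.
have mB := @measurable_eball R N r.
have -> : (\int[leb]_x (g x ^+ 2)%:E = \int[leb]_x (g x ^+ 2 * \1_(eball r)
  x)%:E)%E.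
  apply: ge0_ae_eq_integral => //.
  - by apply/measurable_EFinP; exact: measurable_funX.
  - by apply/measurable_EFinP; apply: measurable_funM;
    [exact: measurable_funX|exact: measurable_indic].
  - by move=> x _; rewrite lee_fin sqr_ge0.
  - by move=> x _; rewrite lee_fin mulr_ge0 ?sqr_ge0.
  - apply: filterS g0 => x gx _; congr EFin; rewrite indicE.
    have [_|/negP xB] := boolP (x \in eball r); first by rewrite mulr1.
    by rewrite gx ?expr0n ?mul0r// => /mem_set.
rewrite lee_pdivlMl// gagliardo2E (fubini_tonelli1 (fun p =>
  (gagliardo_integrand s g p)%:E)); first last.
- by move=> p; rewrite lee_fin gagliardo_integrand_ge0.
- by apply/measurable_EFinP; exact: measurable_gagliardo_integrand.
rewrite -ge0_integralZl_EFin//; first last.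
- exact: ltW.
- by apply/measurable_EFinP; apply: measurable_funM;
  [exact: measurable_funX|exact: measurable_indic].
- by move=> x _; rewrite lee_fin mulr_ge0 ?sqr_ge0.
apply: ge0_le_integral => //.
- move=> x _; rewrite -EFinM lee_fin; apply: mulr_ge0; first exact: ltW.
  by rewrite mulr_ge0 ?sqr_ge0.
- apply: measurable_funeM; apply/measurable_EFinP; apply: measurable_funM.
    exact: measurable_funX.
  exact: measurable_indic.
- apply: measurable_fun_fubini_tonelli_F.
    by apply/measurable_EFinP; exact: measurable_gagliardo_integrand.
  by move=> p; rewrite lee_fin gagliardo_integrand_ge0.
move=> x _; rewrite /fubini_F indicE.
have [/set_mem xB|_] := boolP (x \in eball r); last first.
  rewrite mulr0 mule0; apply: integral_ge0 => y _.
  by rewrite lee_fin gagliardo_integrand_ge0.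
have mS := measurable_far_ball r.
have -> : ((c * V)%:E * (g x ^+ 2 * true%:R)%:E =
    \int[leb]_y ((c * g x ^+ 2)%:E * (\1_(far_ball r) y)%:E))%E.
  rewrite ge0_integralZl_EFin//.
  - transitivity ((c * g x ^+ 2)%:E * leb (far_ball r))%E.
      by rewrite VE -!EFinM; congr EFin; rewrite /= mulr1; ring.
    by rewrite integral_indic// setIT.
  - exact/measurable_EFinP/measurable_indic.
  - by rewrite mulr_ge0 ?sqr_ge0// ltW.
have mgx : measurable_fun setT (fun y => (gagliardo_integrand s g (x, y))%:E).
  have := measurable_gagliardo_integrand s mg.
  by move=> /(measurable_fun_pair2 x) h; apply/measurable_EFinP.
apply: ae_ge0_le_integral => //.
- by move=> y _; rewrite -EFinM lee_fin mulr_ge0// mulr_ge0 ?sqr_ge0// ltW.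
- by apply: measurable_funeM; exact/measurable_EFinP/measurable_indic.
- by move=> y _; rewrite lee_fin gagliardo_integrand_ge0.
apply: filterS g0 => y gy _; rewrite -EFinM lee_fin indicE.
have [/set_mem yS|_] := boolP (y \in far_ball r); last first.
  by rewrite mulr0 gagliardo_integrand_ge0.
rewrite mulr1 /gagliardo_integrand /= gy ?subr0.
  by rewrite mulrC ler_wpM2l ?sqr_ge0// ck.
move=> yB; have := far_ball_coord (Ordinal hN) yS.
have := le_lt_trans (normr_coord_le y (Ordinal hN)) yB.
move=> /(le_lt_trans (ler_norm _)) h1 h2.
by have := lt_trans h1 h2; rewrite ltxx.
Qed.

Lemma hs_norm2_le B g : measurable B -> measurable_fun setT g ->
  (hs_norm2 s B g <= \int[leb]_x (g x ^+ 2)%:E + gagliardo2 s setT g)%E.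
Proof.
move=> mB mg; apply: leeD.
  apply: ge0_subset_integral => //.
    by apply/measurable_EFinP; exact: measurable_funX.
  by move=> x _; rewrite lee_fin sqr_ge0.
rewrite gagliardo2E /gagliardo2; apply: ge0_subset_integral => //.
- exact: measurableX.
- by apply/measurable_EFinP; exact: measurable_gagliardo_integrand.
- by move=> p _; rewrite lee_fin gagliardo_integrand_ge0.
Qed.

End poincare.

(** * Behaviour under dilations *)

Section dilation.
Context {R : realType} {N : nat}.
Implicit Types (u : 'rV[R]_N -> R) (A : set 'rV[R]_N).

Lemma measurable_dilation u (c : R) : measurable_fun setT u ->
  measurable_fun setT (fun x : 'rV[R]_N => u (c *: x)).
Proof.
move=> mu; have := measurableT_comp mu (@measurable_affine R N c 0).
by apply: eq_measurable_fun => x _ /=; rewrite addr0.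
Qed.

Lemma ge0_integral_rV2_dilation (c : R) (F : 'rV[R]_N * 'rV[R]_N -> \bar R) :
  0 < c -> measurable_fun setT F -> (forall p, (0 <= F p)%E) ->
  (\int[lebesgue_rV N \x lebesgue_rV N]_p F (c *: p.1, c *: p.2) =
   (c ^- N * c ^- N)%:E * \int[lebesgue_rV N \x lebesgue_rV N]_p F p)%E.
Proof.
move=> c0 mF F0.
have cN0 : 0 <= c ^- N by rewrite invr_ge0 exprn_ge0// ltW.
have mc : measurable_fun setT (fun x : 'rV[R]_N => c *: x).
  have := @measurable_affine R N c 0.
  by apply: eq_measurable_fun => x _ /=; rewrite addr0.
have mFc : measurable_fun setT (fun p : 'rV[R]_N * 'rV[R]_N => F (c *: p.1, c
  *: p.2)).
  apply: (measurableT_comp mF); apply: measurable_fun_pair.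
    exact: (measurableT_comp mc measurable_fst).
  exact: (measurableT_comp mc measurable_snd).
pose G x := (\int[lebesgue_rV N]_y F (x, y))%E.
have G0 x : (0 <= G x)%E by apply: integral_ge0.
have mG : measurable_fun setT G := measurable_fun_fubini_tonelli_F F mF F0.
have GE x : (\int[lebesgue_rV N]_y F (c *: x, c *: y)%R =
    (c ^- N)%:E * G (c *: x + 0)%R)%E.
  rewrite addr0 -(@ge0_integral_rV_affine R N (fun y => F (c *: x, y)) c 0
    c0)//.
    by apply: eq_integral => y _; rewrite addr0.
  exact: (measurable_fun_pair2 _ mF).
transitivity (\int[lebesgue_rV N]_x ((c ^- N)%:E * G (c *: x + 0)%R))%E.
  transitivity (\int[lebesgue_rV N]_x fubini_F (lebesgue_rV N)
      (fun p : 'rV[R]_N * 'rV[R]_N => F (c *: p.1, c *: p.2)) x)%E.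
    exact: (fubini_tonelli1 _ mFc (fun p => F0 _)).
  by apply: eq_integral => x _; exact: GE.
have mGc := measurableT_comp mG (@measurable_affine R N c 0).
rewrite (ge0_integralZl_EFin _ measurableT (fun x _ => G0 _) mGc cN0).
rewrite (@ge0_integral_rV_affine R N G c 0)// muleA -EFinM; congr (_ * _)%E.
by rewrite (fubini_tonelli1 F mF F0).
Qed.

(** The two volume factors give c^(-2N) and the homogeneity of the kernel gives c^(N+2s). *)
Lemma gagliardo2_dilation (s c : R) u : 0 < c -> measurable_fun setT u ->
  (gagliardo2 s setT (fun x => u (c *: x)%R) =
   (c `^ (2 * s - N%:R))%:E * gagliardo2 s setT u)%E.
Proof.
move=> c0 mu; rewrite !gagliardo2E.
have mg := measurable_gagliardo_integrand s mu.
transitivity (\int[lebesgue_rV N \x lebesgue_rV N]_p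
  (c `^ (N%:R + 2 * s) * gagliardo_integrand s u (c *: p.1, c *: p.2))%:E)%E.
  apply: eq_integral => p _; congr EFin; rewrite /gagliardo_integrand /=.
  rewrite /gagliardo_kernel /= -scalerBr enormZ (gtr0_norm c0).
  rewrite (powRM _ (ltW c0) (enorm_ge0 _)) (powRN c).
  by field; rewrite gt_eqF// powR_gt0.
rewrite (@ge0_integral_rV2_dilation c
  (fun p => (c `^ (N%:R + 2 * s) * gagliardo_integrand s u p)%:E))//.
- under eq_integral do rewrite EFinM.
  rewrite ge0_integralZl_EFin ?powR_ge0//.
  + rewrite muleA -EFinM; congr (_%:E * _)%E.
    rewrite -(powR_mulrn N (ltW c0)) -powRN.
    have cneq0 : c != 0 by rewrite gt_eqF.
    rewrite -powRD ?cneq0 ?implybT// -powRD ?cneq0 ?implybT//.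
    by congr (_ `^ _); ring.
  + by move=> p _; rewrite lee_fin gagliardo_integrand_ge0.
  + exact/measurable_EFinP.
- by apply/measurable_EFinP; exact: measurable_funM.
- by move=> p; rewrite lee_fin mulr_ge0 ?powR_ge0 ?gagliardo_integrand_ge0.
Qed.

Lemma ae_dilation (c : R) (P : 'rV[R]_N -> Prop) : 0 < c ->
  {ae lebesgue_rV N, forall x, P x} -> {ae lebesgue_rV N, forall x, P (c *: x)}.
Proof.
move=> c0 [B [mB B0 PB]]; exists [set x | B (c *: x + 0)]; split.
- rewrite -[X in measurable X]setTI; exact: (measurable_affine c 0).
- by rewrite lebesgue_rV_affine// B0 mule0.
- by move=> x /= Px; rewrite addr0; apply: PB.
Qed.

End dilation.

Section ereal_cvg0.
Context {R : realType}.

Lemma ge0_cvge0P (T : Type) (F : set_system T) {FF : Filter F} (f : T -> \bar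
  R) :
  (forall x, (0 <= f x)%E) ->
  f @ F --> 0%E <-> forall d : R, 0 < d -> \forall x \near F, (f x <= d%:E)%E.
Proof.
move=> f0; split=> [fF d d0|fF A].
  have : nbhs (0%E : \bar R) [set x | (x <= d%:E)%E].
    rewrite /nbhs/= /ereal_nbhs /=.
    have := lt_nbhsl d0; apply: filterS => x; rewrite lee_fin; exact: ltW.
  exact: fF.
rewrite /nbhs/= /ereal_nbhs /= => -[e /= e0 eA].
(* Neighbourhoods of 0 are tested by strict inequalities, hence the half. *)
have := fF (e / 2) (divr_gt0 e0 (ltr0n R 2)); apply: filterS => x fx.
have fxfin : f x \is a fin_num by rewrite ge0_fin_numE// (le_lt_trans fx)//
  ltry.
have := f0 x; move: fx; rewrite /= -(fineK fxfin) !lee_fin => h1 h2.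
apply: eA => /=; rewrite sub0r normrN ger0_norm//; lra.
Qed.

End ereal_cvg0.

(** * The space D^{s,2} *)

Section Ds2_theory.
Context {R : realType} {N : nat} (s : R).
Hypotheses (hN : (1 <= N)%N) (s0 : 0 < s) (s1 : s < 1).
Implicit Types (f g u v zeta : 'rV[R]_N -> R) (A B : set 'rV[R]_N).
Local Notation leb := (lebesgue_rV N).
Local Notation gag := (gagliardo2 s setT).

Lemma gagliardo2B u v : measurable_fun setT u -> measurable_fun setT v ->
  (gag (fun x => (u x - v x)%R) <= 2%:E * gag u + 2%:E * gag v)%E.
Proof.
move=> mu mv; have := gagliardo2D s (@ltr01 R) mu (measurable_funN mv).
by rewrite invr1 gagliardo2N.
Qed.

(** The product estimate is applied to [f] times the constant 1, whose H^s norm squared on a ball is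
    the volume of the ball. *)
Lemma test_function_gagliardo2_lty A f : test_function A f -> (gag f < +oo)%E.
Proof.
move=> tf; have [r r0 fr] := test_function_bounded_support tf.
have fB x : f x != 0 -> eball r x by move=> fx; apply/fr/subset_closure.
have [C C0 /(_ (cst 1) (measurable_cst _))] :=
  gagliardo2_mul_le s0 s1 tf fB (@measurable_eball R N r).
rewrite (_ : (fun x => f x * cst 1 x) = f); last by apply/funext => x;
  rewrite mulr1.
move=> /le_lt_trans; apply; apply: lte_mul_pinfty => //.
rewrite /hs_norm2 (_ : gagliardo2 _ _ _ = 0%E); last first.
  apply: integral0_eq => p _; rewrite subrr expr0n mul0r//.
rewrite adde0 (_ : (fun x => _) = cst 1%E); last first.
  by apply/funext => x; rewrite expr1n.
rewrite integral_cst; last exact: measurable_eball.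
by rewrite mul1e; exact: lebesgue_rV_eball_lty.
Qed.

Lemma Ds2_measurable A u : Ds2 s A u -> measurable_fun setT u.
Proof. by case. Qed.

Lemma Ds2_test_function A f : test_function A f -> Ds2 s A f.
Proof.
move=> tf; have [sf _ _] := tf; split; first exact: smooth_measurable.
exists (fun=> f); split=> //; last first.
  by apply: aeW => x; exact: cvg_cst.
rewrite (_ : (fun _ => _) = cst 0%E); first exact: cvg_cst.
apply/funext => k; rewrite gagliardo2E; apply: integral0_eq => p _.
by rewrite /gagliardo_integrand !subrr expr0n mul0r.
Qed.

Lemma Ds2_subset A B u : A `<=` B -> Ds2 s A u -> Ds2 s B u.
Proof.
move=> AB [mu [phi [tphi gphi aphi]]]; split=> //; exists phi; split=> // k.
exact: test_function_subset AB (tphi k).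
Qed.

Lemma Ds2_approx A u (d : R) : Ds2 s A u -> 0 < d ->
  exists2 phi, test_function A phi & (gag (fun x => (phi x - u x)%R) <= d%:E)%E.
Proof.
move=> [mu [phi [tphi gphi _]]] d0.
move: gphi => /ge0_cvge0P-/(_ (fun=> gagliardo2_ge0 _ _ _) d d0)[k _ /(_ k
  (leqnn k))].
by exists (phi k).
Qed.

Lemma Ds2_gagliardo2_lty A u : Ds2 s A u -> (gag u < +oo)%E.
Proof.
move=> Du; have mu := Ds2_measurable Du.
have [phi tphi gphi] := Ds2_approx Du (@ltr01 R).
have [sphi _ _] := tphi; have mphi := smooth_measurable sphi.
have -> : u = (fun x => phi x - (phi x - u x)).
  by apply/funext => x; rewrite opprB addrC subrK.
apply: (le_lt_trans (gagliardo2B mphi (measurable_funB mphi mu))).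
apply: lte_add_pinfty; apply: lte_mul_pinfty => //.
  exact: test_function_gagliardo2_lty tphi.
by apply: (le_lt_trans gphi); rewrite ltry.
Qed.

Lemma Ds2D A u v : Ds2 s A u -> Ds2 s A v -> Ds2 s A (fun x => u x + v x).
Proof.
move=> [mu [phi [tphi gphi aphi]]] [mv [psi [tpsi gpsi apsi]]].
split; first exact: measurable_funD.
exists (fun k x => phi k x + psi k x); split.
- by move=> k; exact: test_functionD.
- apply/ge0_cvge0P => [k|d d0]; first exact: gagliardo2_ge0.
  have d4 : 0 < d / 4 by rewrite divr_gt0.
  move: gphi => /ge0_cvge0P-/(_ (fun=> gagliardo2_ge0 _ _ _) _ d4) gphi.
  move: gpsi => /ge0_cvge0P-/(_ (fun=> gagliardo2_ge0 _ _ _) _ d4) gpsi.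
  near=> k.
  have [sphi _ _] := tphi k; have [spsi _ _] := tpsi k.
  have m1 := measurable_funB (smooth_measurable sphi) mu.
  have m2 := measurable_funB (smooth_measurable spsi) mv.
  rewrite (_ : (fun x => _) = (fun x => (phi k x - u x) + (psi k x - v x)));
    last first.
    by apply/funext => x; rewrite opprD addrACA.
  apply: (le_trans (gagliardo2D s (@ltr01 R) m1 m2)); rewrite invr1.
  have -> : (d%:E = (1 + 1)%:E * (d / 4)%:E + (1 + 1)%:E * (d / 4)%:E)%E.
    by rewrite -!EFinM -EFinD; congr EFin; field.
  apply: leeD; apply: lee_wpmul2l => //.
    by near: k; exact: gphi.
  by near: k; exact: gpsi.
- apply: filterS2 aphi apsi => x; exact: cvgD.
Unshelve. all: by end_near.
Qed.

Lemma Ds2Z A (c : R) u : Ds2 s A u -> Ds2 s A (fun x => c * u x).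
Proof.
move=> [mu [phi [tphi gphi aphi]]]; split; first exact: measurable_funM.
exists (fun k x => c * phi k x); split.
- by move=> k; exact: test_functionZ.
- apply/ge0_cvge0P => [k|d d0]; first exact: gagliardo2_ge0.
  have c2 : 0 < c ^+ 2 + 1 by rewrite ltr_wpDl ?sqr_ge0.
  move: gphi => /ge0_cvge0P-/(_ (fun=> gagliardo2_ge0 _ _ _) _ (divr_gt0 d0
    c2)).
  apply: filterS => k gk; have [sphi _ _] := tphi k.
  rewrite (_ : (fun x => _) = (fun x => c * (phi k x - u x))); last first.
    by apply/funext => x; rewrite mulrBr.
  rewrite gagliardo2Z; last exact: measurable_funB (smooth_measurable sphi) mu.
  apply: (@le_trans _ _ ((c ^+ 2)%:E * (d / (c ^+ 2 + 1))%:E)%E).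
    by apply: lee_wpmul2l => //; rewrite lee_fin sqr_ge0.
  rewrite -EFinM lee_fin mulrA ler_pdivrMr// mulrC ler_wpM2l ?lerDl//.
  exact: ltW.
- by apply: filterS aphi => x; apply: cvgMr.
Qed.

Lemma Ds2B A u v : Ds2 s A u -> Ds2 s A v -> Ds2 s A (fun x => u x - v x).
Proof.
move=> Du Dv; rewrite (_ : (fun _ => _) = (fun x => u x + -1 * v x)).
  by apply: Ds2D => //; exact: Ds2Z.
by apply/funext => x; rewrite mulN1r.
Qed.

Lemma Ds2_ae_support A (r : R) u : A `<=` eball r -> Ds2 s A u ->
  {ae leb, forall x, ~ eball r x -> u x = 0}.
Proof.
move=> Ar [mu [phi [tphi _ aphi]]]; apply: filterS aphi => x phix xr.
have phi0 : (fun k => phi k x) = cst 0.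
  apply/funext => k; apply/eqP; apply: contra_notT xr => xk.
  by apply: Ar; exact: test_function_support (tphi k) xk.
by rewrite phi0 in phix; exact: cvg_unique phix (cvg_cst _).
Qed.

(* On a bounded set the Poincare inequality turns fast Gagliardo convergence
   into almost everywhere convergence. *)
Lemma Ds2_closure A (r : R) u : 0 < r -> A `<=` eball r ->
  measurable_fun setT u -> {ae leb, forall x, ~ eball r x -> u x = 0} ->
  (forall d : R, 0 < d -> exists2 phi, test_function A phi &
    (gag (fun x => (phi x - u x)%R) <= d%:E)%E) ->
  Ds2 s A u.
Proof.
move=> r0 Ar mu u0 uA; split=> //.
(* The rate 2^-k makes the integrals of the squared errors summable. Their pointwise sum [S] is then
   integrable, hence finite almost everywhere, and its terms tend to 0 there. *)
have /choice[phi phiP] : forall k : nat, exists phi, test_function A phi /\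
    (gag (fun x => (phi x - u x)%R) <= (2^-1 ^+ k)%:E)%E.
  move=> k; have [|phi] := uA (2^-1 ^+ k); first by rewrite exprn_gt0.
  by exists phi.
have mphi k : measurable_fun setT (fun x => phi k x - u x).
  by have [[sphi _ _] _] := phiP k; exact: measurable_funB (smooth_measurable
    sphi) mu.
have [C C0 CP] := gagliardo2_poincare hN s0 r0.
have L2 k : (\int[leb]_x ((phi k x - u x) ^+ 2)%:E <= (2^-1 ^+ k)%:E * C%:E)%E.
  apply: (le_trans (CP _ (mphi k) _)).
    apply: filterS u0 => x ux xr; rewrite ux// subr0; apply/eqP.
    apply: contra_notT xr => xk.
    by apply: Ar; exact: test_function_support (phiP k).1 xk.
  by rewrite muleC; apply: lee_wpmul2r => //; exact: (phiP k).2.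
have msq k : measurable_fun setT (fun x => ((phi k x - u x) ^+ 2)%:E).
  by apply/measurable_EFinP; exact: measurable_funX.
have sq0 k x : (0 <= ((phi k x - u x) ^+ 2)%:E)%E by rewrite lee_fin sqr_ge0.
pose S x := (\sum_(0 <= k <oo) ((phi k x - u x) ^+ 2)%:E)%E.
have mS : measurable_fun setT S by apply: ge0_emeasurable_sum.
have S0 x : (0 <= S x)%E by apply: nneseries_ge0 => k _ _; exact: sq0.
have IS : (\int[leb]_x S x < +oo)%E.
  rewrite integral_nneseries//.
  apply: (@le_lt_trans _ _ (\sum_(0 <= k <oo) ((2^-1 ^+ k)%:E * C%:E))%E).
    by apply: lee_nneseries => [k _ _|k _]; [apply: integral_ge0|exact: L2].
  apply: nneseries_geometric_lty; [|by rewrite lee_fin|exact: ltry].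
  by rewrite invr_ge0 ler0n/= invf_lt1// ltr1n.
have aS : {ae leb, forall x, S x \is a fin_num}.
  have iS : leb.-integrable setT S.
    apply/integrableP; split=> //.
    by under eq_integral do rewrite gee0_abs//.
  by have := integrable_ae measurableT iS; apply: filterS => x; exact.
exists phi; split.
- by move=> k; exact: (phiP k).1.
- apply/ge0_cvge0P => [k|d d0]; first exact: gagliardo2_ge0.
  have := @cvg_expr R 2^-1 _; rewrite ger0_norm// invf_lt1// ltr1n => /(_ isT).
  move=> /cvgr0Pnorm_le /(_ d d0); apply: filterS => k kd.
  apply: (le_trans (phiP k).2); rewrite lee_fin.
  exact: le_trans (ler_norm _) kd.
- apply: filterS aS => x Sx.
  have sq_cvg : (((phi k x - u x) ^+ 2)%:E @[k --> \oo] --> 0)%E.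
    have tail : (\sum_(n <= k <oo) ((phi k x - u x) ^+ 2)%:E)%E @[n --> \oo]
      --> 0%E.
      by apply: nneseries_tail_cvg => //; rewrite ltey_eq Sx.
    apply: (squeeze_cvge _ _ tail); last exact: (cvg_cst 0%E).
    apply: nearW => k; rewrite sq0/=.
    apply: (le_trans _ (@nneseries_lim_ge R (fun i => ((phi i x - u x) ^+
      2)%:E) xpredT k k.+1 _)) => //.
    by rewrite big_nat1.
  apply/cvgrPdist_le => e e0.
  have near_e : \forall k \near \oo, (((phi k x - u x) ^+ 2)%:E <= (e ^+
    2)%:E)%E.
    by move: sq_cvg => /ge0_cvge0P; apply => //; exact: exprn_gt0.
  apply: filterS near_e => k.
  rewrite lee_fin distrC -[in leLHS]real_normK ?num_real//.
  by rewrite ler_pXn2r// nnegrE ltW.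
Qed.

(* The Poincare inequality on the bounded set [A'] provides the L^2 part of the
   norm in [gagliardo2_mul_le]. *)
Lemma Ds2_mul A A' (r : R) zeta u : 0 < r -> A' `<=` eball r -> Ds2 s A' u ->
  test_function A zeta -> Ds2 s A (fun x => zeta x * u x).
Proof.
move=> r0 A'r Du tz; have mu := Ds2_measurable Du.
have [sz _ _] := tz; have mz := smooth_measurable sz.
have [C C0 CP] := gagliardo2_poincare hN s0 r0.
have [rz rz0 zr] := test_function_bounded_support tz.
have zB x : zeta x != 0 -> eball rz x by move=> zx; apply/zr/subset_closure.
have [M M0 MP] := gagliardo2_mul_le s0 s1 tz zB (@measurable_eball R N rz).
have u0 := Ds2_ae_support A'r Du.
(* [Ds2_closure] works in a bounded set, whereas [A] is arbitrary; the support of [zeta] provides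
   the ball. *)
suff : Ds2 s (A `&` eball rz) (fun x => zeta x * u x) by apply: Ds2_subset => x
  [].
apply: (@Ds2_closure _ rz) => //.
- exact: measurable_funM.
- apply: aeW => x xrz; apply/eqP; rewrite mulf_eq0; apply/orP; left.
  by apply/eqP; apply: contra_notP xrz => /eqP; exact: zB.
(* The added 1 keeps the divisor positive when [M] is 0. *)
move=> d d0; have MC0 : 0 < M * (C + 1) + 1 by rewrite ltr_wpDl// mulr_ge0//
  addr_ge0.
have [phi tphi gphi] := Ds2_approx Du (divr_gt0 d0 MC0).
have [sphi _ _] := tphi; have mphi := smooth_measurable sphi.
exists (fun x => zeta x * phi x).
  apply: (@test_function_sub _ _ A _ zeta) => //.
  - exact: smoothM.
  - by move=> x; rewrite mulf_eq0 negb_or => /andP[].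
  - by move=> x xz; split; [have [_ _] := tz; exact|exact: zr].
rewrite (_ : (fun x => _) = (fun x => zeta x * (phi x - u x))); last first.
  by apply/funext => x; rewrite mulrBr.
have mg := measurable_funB mphi mu.
apply: (le_trans (MP _ mg)).
apply: (@le_trans _ _ ((M * (C + 1))%:E * gag (fun x => (phi x - u x)%R))%E).
  rewrite EFinM -muleA; apply: lee_wpmul2l; first by rewrite lee_fin.
  apply: (le_trans (hs_norm2_le s (@measurable_eball R N rz) mg)).
  rewrite EFinD ge0_muleDl ?lee_fin// mul1e; apply: leeD => //; apply: CP => //.
  apply: filterS u0 => x ux xr; rewrite /= ux// subr0; apply/eqP.
  apply: contra_notT xr => xk.
  by apply: A'r; exact: test_function_support tphi xk.
apply: (@le_trans _ _ ((M * (C + 1))%:E * (d / (M * (C + 1) + 1))%:E)%E).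
  by apply: lee_wpmul2l => //; rewrite lee_fin mulr_ge0// addr_ge0.
rewrite -EFinM lee_fin mulrA ler_pdivrMr// mulrC ler_wpM2l ?lerDl//.
exact: ltW.
Qed.

(** This is how a profile with no global energy bound gets into the space after localization: [f]
    need only be approximated in H^s of the ball. *)
Lemma Ds2_mul_limit (r : R) zeta f : 0 < r -> test_function (eball r) zeta ->
  measurable_fun setT f ->
  (forall d : R, 0 < d -> exists v, [/\ measurable_fun setT v,
     Ds2 s (eball r) (fun x => zeta x * v x) &
     (hs_norm2 s (eball r) (fun x => (v x - f x)%R) <= d%:E)%E]) ->
  Ds2 s (eball r) (fun x => zeta x * f x).
Proof.
move=> r0 tz mf fA; have [sz _ _] := tz; have mz := smooth_measurable sz.
have zB x : zeta x != 0 -> eball r x by exact: test_function_support tz.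
have [M M0 MP] := gagliardo2_mul_le s0 s1 tz zB (@measurable_eball R N r).
apply: (@Ds2_closure _ r) => //.
- exact: measurable_funM.
- apply: aeW => x xr; apply/eqP; rewrite mulf_eq0; apply/orP; left.
  by apply/eqP; apply: contra_notP xr => /eqP; exact: zB.
move=> d d0; have M10 : 0 < 4 * (M + 1) by rewrite mulr_gt0// ltr_wpDl.
have [v [mv Dv hv]] := fA _ (divr_gt0 d0 M10).
have d4 : 0 < d / 4 by rewrite divr_gt0.
have [phi tphi gphi] := Ds2_approx Dv d4.
have [sphi _ _] := tphi; have mphi := smooth_measurable sphi.
exists phi => //.
rewrite (_ : (fun x => _) =
    (fun x => (phi x - zeta x * v x) + zeta x * (v x - f x))); last first.
  by apply/funext => x; rewrite mulrBr addrA subrK.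
have m1 : measurable_fun setT (fun x => phi x - zeta x * v x).
  by apply: measurable_funB => //; exact: measurable_funM.
have m2 : measurable_fun setT (fun x => v x - f x) by exact: measurable_funB.
have m3 : measurable_fun setT (fun x => zeta x * (v x - f x)) by exact:
  measurable_funM.
apply: (le_trans (gagliardo2D s (@ltr01 R) m1 m3)); rewrite invr1.
have -> : (d%:E = (1 + 1)%:E * (d / 4)%:E + (1 + 1)%:E * (d / 4)%:E)%E.
  by rewrite -!EFinM -EFinD; congr EFin; field.
apply: leeD; apply: lee_wpmul2l => //.
apply: (le_trans (MP _ m2)).
apply: (@le_trans _ _ (M%:E * (d / (4 * (M + 1)))%:E)%E).
  by apply: lee_wpmul2l => //; rewrite lee_fin.
rewrite -EFinM lee_fin; have -> : d / 4 = (M + 1) * (d / (4 * (M + 1))).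
  by field; rewrite gt_eqF// ltr_wpDl.
by rewrite ler_wpM2r ?lerDl// ltW// divr_gt0.
Qed.

End Ds2_theory.

(** * Capacity *)

Section cutoffs.
Context {R : realType} {N : nat}.
Implicit Types (f zeta : 'rV[R]_N -> R) (A B K : set 'rV[R]_N).

Lemma cutoff_exists K : compact K -> exists zeta, cutoff setT K zeta.
Proof.
move=> cK; have [M [Mr KM]] := compact_bounded cK.
pose rho := N%:R * (`|M| + 1) + 1.
have rho0 : 0 < rho by rewrite ltr_wpDl// mulr_ge0// addr_ge0.
have Krho : K `<=` eball rho.
  move=> x Kx; rewrite /eball/=; apply: (le_lt_trans (enorm_le_norm x)).
  rewrite ltr_pwDr// ler_wpM2l//; apply: KM => //.
  by rewrite (le_lt_trans (ler_norm _))// ltrDl.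
(* A radial plateau around [K]; the squared norm is used because it is smooth at the origin. *)
pose zeta (x : 'rV[R]_N) := step (dotv x x - rho ^+ 2).
have szeta : smooth zeta.
  by apply: smooth_step; apply: smoothB; [exact: smooth_dotv|exact: smooth_cst].
pose C := [set x : 'rV[R]_N | `|x| <= rho + 1].
have cC : closed C.
  rewrite (_ : C = (fun x : 'rV[R]_N => `|x|) @^-1` `]-oo, (rho + 1)]%classic);
    last first.
    by apply/seteqP; split => x; rewrite /C/= in_itv.
  apply: closed_comp; last exact: interval_closed.
  by move=> x _; exact: norm_continuous.
have CC : compact C.
  apply: bounded_closed_compact => //; exists (rho + 1); split;
    first exact: num_real.
  by move=> y ry x /le_trans; apply; exact: ltW.
have zC : closure [set x | zeta x != 0] `<=` C.
  rewrite (closure_id C).1//; apply: closure_subset => x /=.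
  apply: contra_neqT; rewrite -ltNge => xC; apply: step_ge1.
  have xr : rho + 1 <= enorm x by apply: ltW; apply: lt_le_trans xC
    (norm_le_enorm x).
  (* Since (rho + 1)^2 >= rho^2 + 1, the argument of [step] is at least 1 there. *)
  rewrite -sqr_enorm lerBrDr; apply: (@le_trans _ _ ((rho + 1) ^+ 2)).
    rewrite sqrrD1 -subr_ge0; have -> : rho ^+ 2 + rho *+ 2 + 1 - (1 + rho ^+
      2) = rho *+ 2 by ring.
    by rewrite mulrn_wge0// ltW.
  by rewrite lerXn2r ?nnegrE ?enorm_ge0// addr_ge0// ltW.
exists zeta; split.
  split=> //.
  by apply: (subclosed_compact _ CC zC); exact: closed_closure.
exists (eball rho); split=> //.
  rewrite (_ : eball rho = (fun x : 'rV[R]_N => dotv x x) @^-1` `]-oo, (rho ^+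
    2)[%classic).
    apply: open_comp; last exact: interval_open.
    by move=> x _; apply: smooth_continuous; exact: smooth_dotv.
  apply/seteqP; split => x; rewrite /eball/= in_itv/= -sqr_enorm.
    by move=> ?; rewrite ltr_pXn2r// ?nnegrE ?enorm_ge0// ltW.
  by rewrite ltr_pXn2r// ?nnegrE ?enorm_ge0// ltW.
move=> x; rewrite /eball/= => xr; apply: step_le0; rewrite subr_le0 -sqr_enorm.
by rewrite lerXn2r ?nnegrE ?enorm_ge0// ltW.
Qed.

(** Both cutoffs equal 1 on a common neighbourhood of [K], so even the closed support of the
    difference avoids [K]. This is what makes one cutoff exchangeable for another. *)
Lemma cutoffB A B K zeta1 zeta2 : A `<=` B ->
  cutoff A K zeta1 -> test_function B zeta2 -> cutoff setT K zeta2 ->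
  test_function (B `\` K) (fun x => zeta1 x - zeta2 x).
Proof.
move=> AB [t1 [U1 [oU1 KU1 U1z]]] t2 [_ [U2 [oU2 KU2 U2z]]].
have [sz cz zB] := test_functionB (test_function_subset AB t1) t2.
split=> // x xz; split; first exact: zB.
move=> Kx; have nU : nbhs x (U1 `&` U2).
  apply: open_nbhs_nbhs; split; first exact: openI.
  by split; [exact: KU1|exact: KU2].
have [y [/= yz [yU1 yU2]]] := xz _ nU.
by move: yz; rewrite U1z// U2z// subrr eqxx.
Qed.

Lemma scale_continuous (c : R) : continuous (fun x : 'rV[R]_N => c *: x).
Proof. exact: scaler_continuous. Qed.

Lemma test_function_dilation (c : R) A f : 0 < c -> test_function A f ->
  test_function [set x | A (c *: x)] (fun x => f (c *: x)).
Proof.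
move=> c0 [sf cf fA].
have S : closure [set x | f (c *: x) != 0] `<=`
    [set x | closure [set y | f y != 0] (c *: x)].
  have cl : closed [set x | closure [set y | f y != 0] (c *: x)].
    have := @closed_comp _ _ (fun x : 'rV[R]_N => c *: x) _
      (fun x _ => @scale_continuous c x) (@closed_closure _ [set y | f y != 0]).
    exact.
  rewrite [X in _ `<=` X](closure_id _).1//; apply: closure_subset => x /= fx.
  exact: subset_closure.
split; first exact: smooth_scale.
- have cS : compact [set x | closure [set y | f y != 0] (c *: x)].
    rewrite (_ : [set x | _] =
      (fun x : 'rV[R]_N => c^-1 *: x) @` closure [set y | f y != 0]).
      apply: continuous_compact cf; apply: continuous_subspaceT.
      exact: scale_continuous.
    apply/seteqP; split => x /=.
      by move=> cx; exists (c *: x) => //; rewrite scalerA mulVf ?gt_eqF//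
        scale1r.
    by move=> [y cy <-]; rewrite scalerA mulfV ?gt_eqF// scale1r.
  by apply: (subclosed_compact _ cS S); exact: closed_closure.
- by apply: (subset_trans S) => x /=; exact: fA.
Qed.

Lemma cutoff_dilation (c : R) A K zeta : 0 < c -> cutoff A K zeta ->
  cutoff [set x | A (c *: x)] [set x | K (c *: x)] (fun x => zeta (c *: x)).
Proof.
move=> c0 [tz [U [oU KU Uz]]]; split; first exact: test_function_dilation.
exists [set x | U (c *: x)]; split.
- have := @open_comp _ _ (fun x : 'rV[R]_N => c *: x) _
      (fun x _ => @scale_continuous c x) oU.
  exact.
- by move=> x; exact: KU.
- by move=> x; exact: Uz.
Qed.

End cutoffs.

Section capacity_theory.
Context {R : realType} {N : nat} (s : R).
Hypotheses (hN : (1 <= N)%N) (s0 : 0 < s) (s1 : s < 1).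
Implicit Types (f g u v w zeta : 'rV[R]_N -> R) (A B K : set 'rV[R]_N).
Local Notation leb := (lebesgue_rV N).
Local Notation gag := (gagliardo2 s setT).
Local Notation energy w := (Ds2_form s w w).

Lemma Gamma_ge0 (x : R) : 0 <= Gamma x.
Proof.
apply: fine_ge0; apply: integral_ge0 => t _.
by rewrite lee_fin mulr_ge0 ?powR_ge0 ?expR_ge0.
Qed.

Lemma CNs_ge0 : 0 <= CNs N s.
Proof.
apply: mulr_ge0; last by rewrite subr_ge0 ltW.
apply: mulr_ge0; last exact: ltW.
apply: mulr_ge0; first by rewrite mulr_ge0 ?powR_ge0.
by rewrite divr_ge0 ?Gamma_ge0.
Qed.

Lemma Ds2_formE w : energy w = CNs N s / 2 * fine (gag w).
Proof. by rewrite gagliardo2E. Qed.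

Lemma energy_ge0 w : 0 <= energy w.
Proof.
rewrite Ds2_formE mulr_ge0// ?fine_ge0 ?gagliardo2_ge0//.
by rewrite divr_ge0// CNs_ge0.
Qed.

(** Finiteness is assumed because the real-valued form sends an infinite seminorm to 0, which would
    falsify the inequality. *)
Lemma energyD u v (t : R) : 0 < t ->
  measurable_fun setT u -> measurable_fun setT v ->
  (gag u < +oo)%E -> (gag v < +oo)%E ->
  energy (fun x => u x + v x) <= (1 + t) * energy u + (1 + t^-1) * energy v.
Proof.
move=> t0 mu mv gu gv; rewrite !Ds2_formE.
have fu : gag u \is a fin_num by rewrite ge0_fin_numE// gagliardo2_ge0.
have fv : gag v \is a fin_num by rewrite ge0_fin_numE// gagliardo2_ge0.
have := gagliardo2D s t0 mu mv.
rewrite -[in leRHS](fineK fu) -[in leRHS](fineK fv) -!EFinM -EFinD => guv.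
have fuv : gag (fun x => u x + v x) \is a fin_num.
  by rewrite ge0_fin_numE ?gagliardo2_ge0// (le_lt_trans guv)// ltry.
move: guv; rewrite -(fineK fuv) lee_fin => guv.
have c0 : 0 <= CNs N s / 2 by rewrite divr_ge0// CNs_ge0.
have := ler_wpM2l c0 guv; rewrite mulrDr => /le_trans; apply.
by rewrite (mulrCA _ (1 + t)) (mulrCA _ (1 + t^-1)).
Qed.

Lemma Ds2_dilation (c : R) A u : 0 < c -> Ds2 s A u ->
  Ds2 s [set x | A (c *: x)] (fun x => u (c *: x)).
Proof.
move=> c0 [mu [phi [tphi gphi aphi]]]; split; first exact: measurable_dilation.
exists (fun k x => phi k (c *: x)); split.
- by move=> k; exact: test_function_dilation.
- apply/ge0_cvge0P => [k|d d0]; first exact: gagliardo2_ge0.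
  have ck : 0 < c `^ (2 * s - N%:R) by exact: powR_gt0.
  move: gphi => /ge0_cvge0P-/(_ (fun=> gagliardo2_ge0 _ _ _) _ (divr_gt0 d0
    ck)).
  apply: filterS => k gk; have [sphi _ _] := tphi k.
  have := gagliardo2_dilation s c0 (measurable_funB (smooth_measurable sphi)
    mu).
  move=> /= ->; apply: (@le_trans _ _ ((c `^ (2 * s - N%:R))%:E * (d / c `^ (2
    * s - N%:R))%:E)%E).
    by apply: lee_wpmul2l => //; rewrite lee_fin ltW.
  by rewrite -EFinM lee_fin mulrC divfK ?gt_eqF.
- exact: (ae_dilation c0 aphi).
Qed.

(** Dilating and scaling sends competitors to competitors, cutoffs included. One inequality is
    enough, the inverse dilation giving the other. *)
Lemma capacity_dilation_le (a c : R) A K u : a != 0 -> 0 < c ->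
  (capacity s [set x | A (c *: x)%R] [set x | K (c *: x)%R]
     (fun x => (a * u (c *: x))%R) <=
   (a ^+ 2 * c `^ (2 * s - N%:R))%:E * capacity s A K u)%E.
Proof.
move=> a0 c0; set k := a ^+ 2 * _.
have k0 : 0 < k by rewrite mulr_gt0 ?powR_gt0// lt0r sqrf_eq0 a0 sqr_ge0.
rewrite -lee_pdivrMl//; apply: le_ereal_inf_tmp => _ [w [Dw [zeta cz Dz]] <-].
rewrite lee_pdivrMl//; apply: ereal_inf_lbound.
have mw := Ds2_measurable Dw.
exists (fun x => a * w (c *: x)).
  split; first by apply: Ds2Z => //; exact: Ds2_dilation.
  exists (fun x => zeta (c *: x)); first exact: cutoff_dilation.
  have := Ds2Z a (Ds2_dilation c0 Dz).
  congr (Ds2 s _ _); apply/funext => x.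
  by rewrite mulrBr; congr (_ - _); rewrite mulrCA.
rewrite -EFinM; congr EFin; rewrite !Ds2_formE gagliardo2Z;
  last exact: measurable_dilation.
rewrite gagliardo2_dilation//.
have fw : gag w \is a fin_num.
  by rewrite ge0_fin_numE ?gagliardo2_ge0// (Ds2_gagliardo2_lty s0 s1 Dw).
by rewrite -(fineK fw) -!EFinM /= /k; ring.
Qed.

End capacity_theory.

(** * Convergence of the capacities *)

Section capacity_limit.
Context {R : realType} {N : nat} (s : R).
Hypotheses (hN : (1 <= N)%N) (s0 : 0 < s) (s1 : s < 1).
Local Notation gag := (gagliardo2 s setT).
Local Notation energy w := (Ds2_form s w w).

(** Abstract setting along a proper filter: [D i] stands for the dilated domain and [v i] for the
    rescaled eigenfunction. *)
Context (T : Type) (F : set_system T) {PF : ProperFilter F}.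
Context (D : T -> set 'rV[R]_N) (v : T -> 'rV[R]_N -> R) (psi : 'rV[R]_N -> R).
Context (K : set 'rV[R]_N).
Hypotheses (cK : compact K) (mpsi : measurable_fun setT psi)
  (D_large : forall r : R, \forall i \near F, eball r `<=` D i)
  (D_bounded : \forall i \near F, exists2 r : R, 0 < r & D i `<=` eball r)
  (v_Ds2 : \forall i \near F, Ds2 s (D i) (v i))
  (v_cvg : forall r : R, 0 < r ->
    hs_norm2 s (eball r) (fun x => v i x - psi x) @[i --> F] --> 0%E).

Lemma hs_norm2_ge0 (A : set 'rV[R]_N) (g : 'rV[R]_N -> R) : (0 <= hs_norm2 s A
  g)%E.
Proof.
apply: adde_ge0; last exact: gagliardo2_ge0.
by apply: integral_ge0 => x _; rewrite lee_fin sqr_ge0.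
Qed.

Lemma energy_le (w : 'rV[R]_N -> R) (d : R) : (gag w <= d%:E)%E -> energy w <=
  CNs N s / 2 * d.
Proof.
move=> gd; have fw : gag w \is a fin_num.
  by rewrite ge0_fin_numE ?gagliardo2_ge0// (le_lt_trans gd)// ltry.
rewrite Ds2_formE; apply: ler_wpM2l; first by rewrite divr_ge0// CNs_ge0.
by rewrite -lee_fin fineK.
Qed.

Lemma capacity_ge0 (A B : set 'rV[R]_N) (u : 'rV[R]_N -> R) : (0 <= capacity s
  A B u)%E.
Proof.
by apply: le_ereal_inf_tmp => _ [w _ <-]; rewrite lee_fin energy_ge0.
Qed.

Lemma cutoff_localization (zeta : 'rV[R]_N -> R) : test_function setT zeta ->
  exists r : R, [/\ 0 < r, test_function (eball r) zeta,
    Ds2 s (eball r) (fun x => zeta x * psi x) &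
    forall d : R, 0 < d -> \forall i \near F,
      (gag (fun x => (zeta x * (v i x - psi x))%R) <= d%:E)%E].
Proof.
move=> tz; have [r r0 zr] := test_function_bounded_support tz.
have [sz cz _] := tz; have tzr : test_function (eball r) zeta by [].
exists r; split=> //.
- apply: Ds2_mul_limit => // d d0.
  have := v_cvg r0 => /ge0_cvge0P-/(_ (fun=> hs_norm2_ge0 _ _) d d0) vd.
  (* The filter is proper, so some index meets the three conditions at once; one approximant for
     each [d] suffices. *)
  have [i [[vid [ri ri0 Dri]] Dvi]] :=
    filter_ex (filterI (filterI vd D_bounded) v_Ds2).
  exists (v i); split=> //; first exact: Ds2_measurable Dvi.
  exact: (Ds2_mul hN s0 s1 ri0 Dri Dvi).
move=> d d0.
have zB x : zeta x != 0 -> eball r x by exact: test_function_support tzr.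
have [M M0 MP] := gagliardo2_mul_le s0 s1 tz zB (@measurable_eball R N r).
have M10 : 0 < M + 1 by rewrite ltr_wpDl.
have := v_cvg r0 => /ge0_cvge0P-/(_ (fun=> hs_norm2_ge0 _ _) _ (divr_gt0 d0
  M10)) vd.
apply: filterS2 vd v_Ds2 => i vid Dvi.
have mg := measurable_funB (Ds2_measurable Dvi) mpsi.
apply: (le_trans (MP _ mg)).
apply: (@le_trans _ _ (M%:E * (d / (M + 1))%:E)%E).
  by apply: lee_wpmul2l => //; rewrite lee_fin.
by rewrite -EFinM lee_fin mulrA ler_pdivrMr// mulrC ler_wpM2l ?lerDl// ltW.
Qed.

(** The localized profile is itself a competitor, its constraint function being 0. Finiteness gives
    access to almost optimal competitors. *)
Lemma capacity_profile_fin_num : capacity s setT K psi \is a fin_num.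
Proof.
rewrite ge0_fin_numE ?capacity_ge0//.
have [zeta cz] := cutoff_exists cK; have [tz _] := cz.
have [r [r0 _ Dzpsi _]] := cutoff_localization tz.
apply: (@le_lt_trans _ _ (energy (fun x => zeta x * psi x))%:E);
  last exact: ltry.
apply: ereal_inf_lbound; exists (fun x => zeta x * psi x) => //; split.
  exact: Ds2_subset Dzpsi.
exists zeta => //.
rewrite (_ : (fun x => _) = (fun=> 0)); last by apply/funext => x;
  rewrite subrr.
by apply: Ds2_test_function; exact: test_function0.
Qed.

(* [w' = phi + zeta v_i], where the test function [phi] is close to
   [w - zeta psi], competes for the capacity in [D i]. *)
Lemma capacity_limit_upper (e : R) : 0 < e -> \forall i \near F,
  (capacity s (D i) K (v i) <= capacity s setT K psi + e%:E)%E.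
Proof.
move=> e0; have e4 : 0 < e / 4 by rewrite divr_gt0.
have [_ [w [Dw [zeta cz Dz]] <-]] := lb_ereal_inf_adherent e4
  capacity_profile_fin_num.
rewrite -/(capacity s setT K psi) => wC.
have [tz Uz] := cz; have [r [r0 tzr Dzpsi zv]] := cutoff_localization tz.
have [sz _ _] := tz; have mz := smooth_measurable sz.
have mw := Ds2_measurable Dw; have mDz := Ds2_measurable Dz.
have k0 : 0 <= CNs N s / 2 by rewrite divr_ge0// CNs_ge0.
set k := CNs N s / 2 in k0.
have Q0 := energy_ge0 s0 s1 w.
(* Makes t times the energy of [w] at most e/4; the added 1 covers zero energy. *)
pose t := e / (4 * (energy w + 1)).
have Q1 : 0 < energy w + 1 by rewrite ltr_wpDl.
have t0 : 0 < t by rewrite divr_gt0// mulr_gt0.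
have tQ : t * energy w <= e / 4.
  have -> : e / 4 = t * (energy w + 1) by rewrite /t; field; rewrite gt_eqF.
  by rewrite ler_wpM2l ?lerDl// ltW.
have tV0 : 0 < 1 + t^-1 by rewrite ltr_wpDl// invr_gt0.
(* Two perturbations of squared seminorm at most [d] have joint energy at most 4 k d, which the
   weight 1 + 1/t must keep below e/4. *)
pose d := e / 4 / ((1 + t^-1) * (4 * (k + 1))).
have k1 : 0 < k + 1 by rewrite ltr_wpDl.
have d0 : 0 < d by rewrite divr_gt0// !mulr_gt0.
have dE : (1 + t^-1) * (2 * (k * d) + 2 * (k * d)) <= e / 4.
  have -> : e / 4 = (1 + t^-1) * (4 * (k + 1) * d).
    by rewrite /d [RHS]mulrA [RHS]mulrC divfK// gt_eqF// !mulr_gt0.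
  by rewrite ler_wpM2l ?(ltW tV0)//; have := ltW d0; lra.
have [phi tphi gphi] := Ds2_approx Dz d0.
have [rp rp0 phirp] := test_function_bounded_support tphi.
have [sphi cphi phiK] := tphi; have mphi := smooth_measurable sphi.
have Dr := D_large r; have Drp := D_large rp.
near=> i.
have rD : eball r `<=` D i by near: i; exact: Dr.
have rpD : eball rp `<=` D i by near: i; exact: Drp.
have [ri ri0 Dri] : exists2 r : R, 0 < r & D i `<=` eball r by near: i;
  exact: D_bounded.
have Dvi : Ds2 s (D i) (v i) by near: i; exact: v_Ds2.
have mv := Ds2_measurable Dvi.
have zvd : (gag (fun x => (zeta x * (v i x - psi x))%R) <= d%:E)%E by near: i;
  exact: zv.
have tzD : test_function (D i) zeta := test_function_subset rD tzr.
have tphiDK : test_function (D i `\` K) phi.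
  by split=> // x xphi; split; [exact/rpD/phirp|have [_] := phiK _ xphi].
have tphiD : test_function (D i) phi by apply: test_function_subset tphiDK => x
  [].
pose h1 x := phi x - (w x - zeta x * psi x).
pose h2 x := zeta x * (v i x - psi x).
have mh1 : measurable_fun setT h1 by exact: measurable_funB.
have mh2 : measurable_fun setT h2.
  by apply: measurable_funM => //; exact: measurable_funB.
have gh1 : (gag h1 < +oo)%E by apply: (le_lt_trans gphi); rewrite ltry.
have gh2 : (gag h2 < +oo)%E by apply: (le_lt_trans zvd); rewrite ltry.
have gh : (gag (fun x => (h1 x + h2 x)%R) < +oo)%E.
  apply: (le_lt_trans (gagliardo2D s (@ltr01 R) mh1 mh2)).
  by apply: lte_add_pinfty; apply: lte_mul_pinfty => //;
    rewrite lee_fin addr_ge0.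
pose w' x := w x + (h1 x + h2 x).
have w'E : w' = (fun x => phi x + zeta x * v i x).
  by apply/funext => x; rewrite /w' /h1 /h2; ring.
have mh : measurable_fun setT (fun x => h1 x + h2 x) by exact: measurable_funD.
have Qw' : energy w' <= energy w + e / 2.
  apply: (le_trans (energyD s0 s1 t0 mw mh (Ds2_gagliardo2_lty s0 s1 Dw) gh)).
  have Qh := energyD s0 s1 (@ltr01 R) mh1 mh2 gh1 gh2.
  have Qh1 := energy_le gphi; have Qh2 := energy_le zvd.
  rewrite -/k -/h1 -/h2 in Qh1 Qh2.
  have {}Qh : energy (fun x => h1 x + h2 x) <= 2 * (k * d) + 2 * (k * d).
    apply: (le_trans Qh); rewrite invr1; lra.
  have := ler_wpM2l (ltW tV0) Qh; lra.
apply: (@le_trans _ _ (energy w')%:E).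
  apply: ereal_inf_lbound; exists w' => //; rewrite w'E; split.
    apply: Ds2D => //; first exact: Ds2_test_function.
    exact: (Ds2_mul hN s0 s1 ri0 Dri Dvi).
  exists zeta; first by split.
  rewrite (_ : (fun x => _) = phi); last by apply/funext => x; rewrite addrK.
  exact: Ds2_test_function.
(* Total error: e/4 from the choice of [w] and e/2 from the perturbation. *)
have CE := fineK capacity_profile_fin_num.
move: wC; rewrite -CE -!EFinD lte_fin lee_fin => wC; lra.
Unshelve. all: by end_near.
Qed.

(* [w' = w + zeta (psi - v_i)] competes for the capacity in the whole space: the
   change of cutoff costs [(zeta_i - zeta) v_i], which lies in [D i \ K]. *)
Lemma capacity_limit_lower (e : R) : 0 < e -> \forall i \near F,
  (capacity s setT K psi <= capacity s (D i) K (v i) + e%:E)%E.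
Proof.
move=> e0; have e4 : 0 < e / 4 by rewrite divr_gt0.
have [zeta cz] := cutoff_exists cK.
have [tz Uz] := cz; have [r [r0 tzr Dzpsi zv]] := cutoff_localization tz.
have [sz _ _] := tz; have mz := smooth_measurable sz.
have k0 : 0 <= CNs N s / 2 by rewrite divr_ge0// CNs_ge0.
set k := CNs N s / 2 in k0.
have CE := fineK capacity_profile_fin_num.
set C := fine (capacity s setT K psi) in CE.
have C0 : 0 <= C by apply: fine_ge0; exact: capacity_ge0.
(* The competitor will depend on [i], so [t] and [d] cannot refer to its energy. The upper bound
   with error 1 gives a capacity at most C + 1, and near-optimality adds e/4. *)
pose Qb := C + 1 + e / 4.
have Qb0 : 0 < Qb by rewrite /Qb; lra.
pose t := e / 4 / Qb.
have t0 : 0 < t by rewrite divr_gt0.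
have tQ : t * Qb = e / 4 by rewrite /t divfK// gt_eqF.
have tV0 : 0 < 1 + t^-1 by rewrite ltr_wpDl// invr_gt0.
have k1 : 0 < k + 1 by rewrite ltr_wpDl.
pose d := e / 4 / ((1 + t^-1) * (k + 1)).
have d0 : 0 < d by rewrite divr_gt0// !mulr_gt0.
have dE : (1 + t^-1) * (k * d) <= e / 4.
  have -> : e / 4 = (1 + t^-1) * ((k + 1) * d).
    by rewrite /d [RHS]mulrA [RHS]mulrC divfK// gt_eqF// !mulr_gt0.
  by rewrite ler_wpM2l ?(ltW tV0)//; have := ltW d0; lra.
have Cup := capacity_limit_upper (@ltr01 R).
have Dr := D_large r.
near=> i.
have rD : eball r `<=` D i by near: i; exact: Dr.
have [ri ri0 Dri] : exists2 r : R, 0 < r & D i `<=` eball r by near: i;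
  exact: D_bounded.
have Dvi : Ds2 s (D i) (v i) by near: i; exact: v_Ds2.
have mv := Ds2_measurable Dvi.
have zvd : (gag (fun x => (zeta x * (v i x - psi x))%R) <= d%:E)%E by near: i;
  exact: zv.
have Ci1 : (capacity s (D i) K (v i) <= C%:E + 1%:E)%E by rewrite CE; near: i;
  exact: Cup.
have tzD : test_function (D i) zeta := test_function_subset rD tzr.
have Cif : capacity s (D i) K (v i) \is a fin_num.
  by rewrite ge0_fin_numE ?capacity_ge0// (le_lt_trans Ci1)// -EFinD ltry.
have [_ [w [Dw [zi czi Dzi]] <-]] := lb_ereal_inf_adherent e4 Cif.
rewrite -/(capacity s (D i) K (v i)) -(fineK Cif).
set Ci := fine (capacity s (D i) K (v i)); rewrite -EFinD lte_fin => wCi.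
move: Ci1; rewrite -(fineK Cif) -/Ci -EFinD lee_fin => Ci1.
have mw := Ds2_measurable Dw.
have Q0 := energy_ge0 s0 s1 w.
pose h x := -1 * (zeta x * (v i x - psi x)).
have mh0 : measurable_fun setT (fun x => zeta x * (v i x - psi x)).
  by apply: measurable_funM => //; exact: measurable_funB.
have mh : measurable_fun setT h by exact: measurable_funM.
have gh : (gag h <= d%:E)%E.
  by rewrite gagliardo2Z// sqrrN expr1n mul1e.
have ghoo : (gag h < +oo)%E by apply: (le_lt_trans gh); rewrite ltry.
have Qw' : energy (fun x => w x + h x) <= energy w + e / 2.
  apply: (le_trans (energyD s0 s1 t0 mw mh (Ds2_gagliardo2_lty s0 s1 Dw) ghoo)).
  have Qh := energy_le gh; rewrite -/k in Qh.
  have := ler_wpM2l (ltW tV0) Qh.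
  have : t * energy w <= t * Qb by rewrite ler_wpM2l ?(ltW t0)// /Qb; lra.
  lra.
rewrite -CE -EFinD.
apply: (@le_trans _ _ (energy (fun x => w x + h x))%:E);
  last by rewrite lee_fin; lra.
have Dzv : Ds2 s (D i) (fun x => zeta x * v i x) by exact: (Ds2_mul hN s0 s1
  ri0 Dri Dvi).
rewrite CE; apply: ereal_inf_lbound; exists (fun x => w x + h x) => //; split.
  rewrite (_ : (fun x => _) = (fun x => w x + (zeta x * psi x - zeta x * v i
    x))); last first.
    by apply/funext => x; rewrite /h; ring.
  by apply: Ds2D; [|apply: Ds2B]; [exact: Ds2_subset Dw|exact: Ds2_subset
    Dzpsi|exact: Ds2_subset Dzv].
exists zeta => //.
rewrite (_ : (fun x => _) =
    (fun x => (w x - zi x * v i x) + (zi x - zeta x) * v i x)); last first.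
  by apply/funext => x; rewrite /h; ring.
apply: (@Ds2_subset _ _ _ (D i `\` K)); first by move=> x [].
apply: Ds2D => //; apply: (Ds2_mul hN s0 s1 ri0 Dri Dvi).
exact: (cutoffB (@subset_refl _ (D i)) czi tzD cz).
Unshelve. all: by end_near.
Qed.

End capacity_limit.

(** * Proof of the theorem *)

Section rescaling.
Context {R : realType} {N : nat}.

Lemma near_eball_dilation (Omega : set 'rV[R]_N) : open Omega -> Omega 0 ->
  forall r : R, \forall eps \near 0^'+,
    eball r `<=` [set x | Omega ((eps : R) *: x)].
Proof.
move=> oO O0 r; have /nbhs_ballP[e /= e0 eO] := open_nbhs_nbhs (conj oO O0).
(* The denominator is positive for every real [r], negative ones included. *)
pose d := e / (`|r| + 1).
have r1 : 0 < `|r| + 1 by rewrite ltr_wpDl.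
have d0 : 0 < d by rewrite divr_gt0.
near=> eps => x xr /=; apply: eO.
have eps0 : 0 < eps by near: eps; exact: nbhs_right_gt.
have epsd : eps < d by near: eps; exact: nbhs_right_lt.
rewrite -ball_normE /ball_/= sub0r normrN; apply: (le_lt_trans (norm_le_enorm
  _)).
rewrite enormZ gtr0_norm//; apply: (@le_lt_trans _ _ (eps * (`|r| + 1))).
  rewrite ler_wpM2l ?(ltW eps0)//; apply: (le_trans (ltW xr)).
  by rewrite (le_trans (ler_norm r))// lerDl.
by rewrite -ltr_pdivlMr.
Unshelve. all: by end_near.
Qed.

Lemma bounded_dilation (Omega : set 'rV[R]_N) (eps : R) : bounded_set Omega ->
  0 < eps -> exists2 r : R, 0 < r & [set x | Omega (eps *: x)] `<=` eball r.
Proof.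
move=> [M [Mr OM]] eps0.
exists ((N%:R * (`|M| + 1) + 1) / eps).
  by rewrite divr_gt0// ltr_wpDl// mulr_ge0// addr_ge0.
move=> x /= Ox; rewrite /eball/= ltr_pdivlMr// mulrC.
have -> : eps * enorm x = enorm (eps *: x) by rewrite enormZ gtr0_norm.
apply: (le_lt_trans (enorm_le_norm _)); rewrite ltr_pwDr// ler_wpM2l//.
by apply: OM => //; rewrite (le_lt_trans (ler_norm _))// ltrDl.
Qed.

(** Two opposite uses of [capacity_dilation_le]: dilation 1/eps with amplitude eps^gamma, and
    dilation eps with amplitude eps^(-gamma). The factors are inverse to each other, the first being
    eps^(2 gamma) eps^(N - 2s). *)
Lemma capacity_rescale (s gamma eps : R) (Omega K : set 'rV[R]_N)
    (u : 'rV[R]_N -> R) : 0 < s -> s < 1 -> 0 < eps ->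
  capacity s Omega [set eps *: x | x in K] u =
  ((eps `^ (N%:R + 2 * (gamma - s)))%:E *
   capacity s [set x | Omega (eps *: x)%R] K
     (fun x => (eps `^ (- gamma) * u (eps *: x))%R))%E.
Proof.
move=> s0 s1 eps0; have eps_neq0 : eps != 0 by rewrite gt_eqF.
set k := eps `^ (N%:R + _).
have k0 : 0 < k by exact: powR_gt0.
have epsK (x : 'rV[R]_N) : eps *: (eps^-1 *: x) = x by rewrite scalerA mulfV
  ?scale1r.
have epsVK (x : 'rV[R]_N) : eps^-1 *: (eps *: x) = x by rewrite scalerA mulVf
  ?scale1r.
set Oe := [set x | _]; set ue := (fun x => _ * _).
have KE : [set x | [set eps *: x | x in K] (eps *: x)] = K.
  apply/seteqP; split => x /=; last by exists x.
  by move=> [y Ky /(congr1 ( *:%R eps^-1))]; rewrite !epsVK => <-.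
have KE' : [set x | K (eps^-1 *: x)] = [set eps *: x | x in K].
  apply/seteqP; split => x /=; first by move=> Kx; exists (eps^-1 *: x).
  by move=> [y Ky <-]; rewrite epsVK.
have OE' : [set x | Oe (eps^-1 *: x)] = Omega.
  by apply/seteqP; split => x; rewrite /Oe/= epsK.
have kE : eps `^ gamma ^+ 2 * eps^-1 `^ (2 * s - N%:R) = k.
  rewrite -(powR_mulrn 2 (powR_ge0 _ _)) -powRrM -(powR_inv1 (ltW eps0))
    -powRrM.
  by rewrite -powRD ?eps_neq0 ?implybT//; congr (_ `^ _); ring.
have kE' : eps `^ (- gamma) ^+ 2 * eps `^ (2 * s - N%:R) = k^-1.
  rewrite -(powR_mulrn 2 (powR_ge0 _ _)) -powRrM.
  by rewrite -powRD ?eps_neq0 ?implybT// -powRN; congr (_ `^ _); ring.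
apply/eqP; rewrite eq_le; apply/andP; split.
  have := @capacity_dilation_le R N s s0 s1 (eps `^ gamma) eps^-1 Oe K ue.
  rewrite KE' OE' kE; rewrite (_ : (fun x => _) = u).
    by apply; [rewrite gt_eqF// powR_gt0|rewrite invr_gt0].
  apply/funext => x; rewrite /ue epsK mulrA powRN mulfV ?mul1r//.
  by rewrite gt_eqF// powR_gt0.
have := @capacity_dilation_le R N s s0 s1 (eps `^ (- gamma)) eps Omega
  [set eps *: x | x in K] u.
rewrite KE kE' lee_pdivlMl//; apply=> //.
by rewrite gt_eqF// powR_gt0.
Qed.

End rescaling.

(** The upper bound makes [f] finite only eventually, so the remainder is defined through [fine] and
    the equality is asserted near the limit. *)
Lemma ereal_cvg_remainder (R : realType) (T : Type) (F : set_system T)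
    {FF : Filter F} (C : \bar R) (f : T -> \bar R) :
  C \is a fin_num -> (forall x, 0 <= f x)%E ->
  (forall e : R, 0 < e -> \forall x \near F, (f x <= C + e%:E)%E) ->
  (forall e : R, 0 < e -> \forall x \near F, (C <= f x + e%:E)%E) ->
  exists2 o : T -> R, o x @[x --> F] --> 0 &
    \forall x \near F, f x = (C + (o x)%:E)%E.
Proof.
case: C => // C _ f0 upper lower.
have f_fin x (e : R) : (f x <= C%:E + e%:E)%E -> f x \is a fin_num.
  by move=> fx; rewrite ge0_fin_numE// (le_lt_trans fx)// -EFinD ltry.
exists (fun x => fine (f x) - C).
  apply/cvgr0Pnorm_le => e e0; apply: filterS2 (upper e e0) (lower e e0) => x
    up lo.
  have fx := f_fin _ _ up; move: up lo.
  rewrite -(fineK fx) -!EFinD !lee_fin => up lo.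
  by rewrite ler_norml; apply/andP; split; lra.
apply: filterS (upper 1 ltr01) => x up.
by rewrite -[LHS](fineK (f_fin _ _ up)) -EFinD addrC subrK.
Qed.

Unset Implicit Arguments.

Theorem theorem1p6 (R : realType) (N : nat) (hN : (1 <= N)%N)
  (Omega : set 'rV[R]_N) (hopen : open Omega) (hbounded : bounded_set Omega)
  (h0 : Omega 0)
  (K : set 'rV[R]_N) (hK : compact K) (hKOmega : K `<=` Omega)
  (s : R) (hs0 : 0 < s) (hs1 : s < Num.min 1 (N%:R / 2))
  (j : nat) (hj : (1 <= j)%N)
  (lambda : nat -> R) (hlambda : dirichlet_eigenvalues s Omega lambda)
  (u : 'rV[R]_N -> R) (hu : dirichlet_eigenfunction s Omega (lambda j) u)
  (hu1 : (\int[lebesgue_rV N]_(x in Omega) (`|u x| ^+ 2)%:E = 1)%E)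
  (gamma : R) (psihat : 'rV[R]_N -> R)
  (hprofile : blowup_profile s u gamma psihat) :
  capacity s setT K psihat \is a fin_num /\
  exists2 o : R -> R, o eps @[eps --> 0^'+] --> 0 &
    \forall eps \near 0^'+,
      capacity s Omega [set eps *: x | x in K] u =
      ((eps `^ (N%:R + 2 * (gamma - s)))%:E *
       (capacity s setT K psihat + (o eps)%:E))%E.
Proof.
move: hs1; rewrite lt_min => /andP[s1 _].
have [[Du _] _] := hu; have mu := Ds2_measurable Du.
have [m [k0 [psi [tau [[_ _ _ _ [mtau _]] [_ psiE hcvg _]]]]]] := hprofile.
(* Measurability is read off the polar form: a power of the norm times the trace composed with the
   direction. *)
have mpsi : measurable_fun setT psihat.
  rewrite psiE; apply: measurable_funM.
    exact: (measurableT_comp (measurable_powR _) (@measurable_enorm R N)).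
  exact: (measurableT_comp mtau (@measurable_direction R N)).
pose D (eps : R) := [set x | Omega (eps *: x)].
pose v (eps : R) (x : 'rV[R]_N) := eps `^ (- gamma) * u (eps *: x).
have D_large (r : R) : \forall eps \near 0^'+, eball r `<=` D eps.
  exact: near_eball_dilation.
have D_bounded : \forall eps \near 0^'+, exists2 r : R, 0 < r & D eps `<=`
  eball r.
  near=> eps; apply: bounded_dilation => //; near: eps; exact: nbhs_right_gt.
have v_Ds2 : \forall eps \near 0^'+, Ds2 s (D eps) (v eps).
  near=> eps; have eps0 : 0 < eps by near: eps; exact: nbhs_right_gt.
  exact: Ds2Z (Ds2_dilation eps0 Du).
have Cf := capacity_profile_fin_num (PF := at_right_proper_filter 0) hN hs0 s1
  hK mpsi D_bounded v_Ds2 hcvg.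
have upper := capacity_limit_upper (PF := at_right_proper_filter 0) hN hs0 s1
  hK mpsi D_large D_bounded v_Ds2 hcvg.
have lower := capacity_limit_lower (PF := at_right_proper_filter 0) hN hs0 s1
  hK mpsi D_large D_bounded v_Ds2 hcvg.
split=> //.
have [rem rem0 remE] := ereal_cvg_remainder Cf
  (fun eps => capacity_ge0 hs0 s1 (D eps) K (v eps)) upper lower.
exists rem => //; near=> eps.
have eps0 : 0 < eps by near: eps; exact: nbhs_right_gt.
rewrite (capacity_rescale gamma Omega K u hs0 s1 eps0); congr (_ * _)%E.
by near: eps.
Unshelve. all: by end_near.
Qed.
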